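(* Let $f$ be the exact solution of the Vlasov equation $$\frac{\partial f}{\partial t}+\mathbf{F}\cdot\nabla f=0,\qquad \mathbf{F}=\begin{pmatrix}v\\-E\end{pmatrix},\qquad \nabla=\left(\frac{\partial}{\partial x},\frac{\partial}{\partial v}\right),$$ on the domain $\Omega=\Omega_x\times\Omega_v$. Then $$\frac{d}{dt}\|f(\cdot,\cdot,t)\|_{L^2(\Omega)}^2=0,$$ or, equivalently, $\|f(\cdot,\cdot,t)\|_{L^2(\Omega)}=\|f_0\|_{L^2(\Omega)}$ for every $t\in[0,T[$.
   Context: $\Omega_x=[0,2\pi[$, and $\Omega_v$ is either $]v_{\min},v_{\max}[$ or $\mathbb{R}$. The 1D-1V Vlasov-Poisson system on $t\in[0,T[$ ($T$ finite) is the Vlasov equation $\frac{\partial f}{\partial t}+\mathbf{F}\cdot\nabla f=0$ with $\mathbf{F}=\begin{pmatrix}v\\-E\end{pmatrix}$ and $\nabla=\left(\frac{\partial}{\partial x},\frac{\partial}{\partial v}\right)$, i.e. $\partial_tf+v\,\partial_xf-E\,\partial_vf=0$, coupled with $\partial_xE=1-\int_{\Omega_v}f\,dv$ where $E=E(x,t)$ does not depend on $v$. The initial condition is $f(\cdot,\cdot,0)=f_0$. Both $f$ and $E$ are real-valued and periodic in $x$ with $f(0,v,t)=f(2\pi,v,t)$, $E(0,t)=E(2\pi,t)$. If $\Omega_v=]v_{\min},v_{\max}[$, then $f(x,v_{\min},t)=f(x,v_{\max},t)=0$ for all $x,t$; if $\Omega_v=\mathbb{R}$, then $f$ is rapidly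 decreasing in the sense that $f(x,v,t)\to0$ asymptotically like $e^{-v^2/2}$ for $v\to\pm\infty$. *)

(* Defs.v *)
From HB Require Import structures.
From mathcomp Require Import all_boot all_order all_algebra.
From mathcomp Require Import all_classical all_reals all_analysis.

Set Implicit Arguments.
Unset Strict Implicit.
Unset Printing Implicit Defensive.

Import Order.TTheory GRing.Theory Num.Theory.
Import numFieldNormedType.Exports.

Local Open Scope classical_set_scope.
Local Open Scope ring_scope.

(* Phase-space functions are written f x v t and fields E x t.  They are total;
   only their values for x in R, v in the closure of Omega_v and 0 <= t < T
   are ever constrained or used. *)

Section partial_derivatives.
Context {R : realType}.
Implicit Type f : R -> R -> R -> R.

Definition dx f x v t : R := derive1 (fun y => f y v t) x.
Definition dv f x v t : R := derive1 (fun w => f x w t) v.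
Definition dt f x v t : R := derive1 (fun s => f x v s) t.

Definition uncurry3 f (p : R * R * R) : R := f p.1.1 p.1.2 p.2.

(* Continuously differentiable on the open set D of points (x, v, t). *)
Definition C1_on (D : set (R * R * R)) f : Prop :=
  forall x v t : R, D (x, v, t) ->
    [/\ derivable (fun y => f y v t) x 1,
        derivable (fun w => f x w t) v 1 &
        derivable (fun s => f x v s) t 1] /\
    [/\ {for (x, v, t), continuous (uncurry3 (dx f))},
        {for (x, v, t), continuous (uncurry3 (dv f))} &
        {for (x, v, t), continuous (uncurry3 (dt f))}].

End partial_derivatives.

Section vlasov_poisson.
Context {R : realType}.
Implicit Types (f : R -> R -> R -> R) (E : R -> R -> R) (Omega_v : set R).

(* Second case: f x v t = O(exp (- v^2 / 2)) as v -> +oo and v -> -oo, for each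
   x and t. *)
Definition velocity_condition (T : R) Omega_v f : Prop :=
  (exists vmin vmax : R,
    [/\ vmin < vmax, Omega_v = `]vmin, vmax[%classic &
        forall x t : R, 0 <= t < T -> f x vmin t = 0 /\ f x vmax t = 0]) \/
  (Omega_v = setT /\
    forall x t : R, 0 <= t < T ->
      exists C : R,
        (\forall v \near +oo, `|f x v t| <= C * expR (- (v ^+ 2 / 2))) /\
        (\forall v \near -oo, `|f x v t| <= C * expR (- (v ^+ 2 / 2)))).

(* Classical solution: C^1 in the open region, continuous up to t = 0 and up
   to the velocity boundary.  Functions on Omega_x = [0, 2 pi[ with periodic
   boundary conditions are represented by their 2 pi-periodic extensions. *)
Record vlasov_poisson_solution (T : R) Omega_v (f0 : R -> R -> R) f E : Prop :=
  VlasovPoissonSolution {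
    vp_f_continuous :
      {within [set p : R * R * R | closure Omega_v p.1.2 /\ 0 <= p.2 < T],
        continuous (uncurry3 f)} ;
    vp_f_C1 : C1_on [set p | Omega_v p.1.2 /\ 0 < p.2 < T] f ;
    vp_E_continuous :
      {within [set p : R * R | 0 <= p.2 < T],
        continuous (fun p : R * R => E p.1 p.2)} ;
    vp_f_periodic : forall x v t : R, closure Omega_v v -> 0 <= t < T ->
      f (x + 2 * pi) v t = f x v t ;
    vp_E_periodic : forall x t : R, 0 <= t < T -> E (x + 2 * pi) t = E x t ;
    vp_velocity : velocity_condition T Omega_v f ;
    vp_vlasov : forall x v t : R, Omega_v v -> 0 < t < T ->
      dt f x v t + v * dx f x v t - E x t * dv f x v t = 0 ;
    vp_poisson : forall x t : R, 0 <= t < T ->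
      is_derive x (1 : R) (fun y => E y t)
        (1 - \int[lebesgue_measure]_(v in Omega_v) f x v t) ;
    vp_initial : forall x v : R, Omega_v v -> f x v 0 = f0 x v
  }.

Definition phase_space Omega_v : set (R * R) := `[0, 2 * pi[%classic `*` Omega_v.

Definition L2norm Omega_v (g : R -> R -> R) : \bar R :=
  ('N[(lebesgue_measure \x lebesgue_measure)]_2%:E
     [EFin \o ((fun z : R * R => g z.1 z.2) \_ (phase_space Omega_v))])%E.

End vlasov_poisson.

(* Main.v *)
Require Import Defs.
From mathcomp Require Import all_boot all_order all_algebra.
From mathcomp Require Import all_classical all_reals all_analysis.
From mathcomp Require Import ring lra measurable_realfun.
Import Order.TTheory GRing.Theory Num.Theory.
Import numFieldNormedType.Exports.
Local Open Scope classical_set_scope.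
Local Open Scope ring_scope.

Set Implicit Arguments.
Unset Strict Implicit.
Unset Printing Implicit Defensive.

(** The flow of the field (v, - E) preserves area and the solution is constant
along it, so every integral of a function of the solution is conserved. However,
E is not known in advance to be Lipschitz, the solution need not be differentiable
up to time 0 or up to the boundary in v, and its decay in v is not assumed uniform.
The proof therefore avoids both the flow and differentiation under the integral
sign.

The flow is replaced by one step of the symplectic Euler scheme, [euler_step],
a composition of two shears. Shears preserve Lebesgue measure, so an integral
over one period in x and all v is unchanged by the step
([ge0_integral_euler_step]). The Vlasov equation says that the derivative of the
solution in the direction (v, - E, 1) vanishes; by the mean value theorem the
step changes the solution by o(h), uniformly on compact sets
([transport_step_uniform]).

Compactness is gained by truncation: s ^+ 2 is replaced by [trunc_sq] n, which
vanishes for |s| <= 1 / (n + 1). Provided the solution is uniformly small away from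
a compact set of velocities ([uniform_vanishing]), the two facts above make the
integral of the truncated square a function of time with zero derivative
([trunc_mass_increment]); it is continuous at time 0 ([trunc_mass_cvg0]), hence
constant. Monotone convergence in n then gives the conservation of the L2 norm,
even without knowing that the norm is finite.

The uniform smallness is compactness when the velocities are bounded. On the whole
line the decay is only known for each (x, t) separately. Baire's theorem provides a
window in (x, t), later than the times of interest, where it is uniform
([small_window]). A fast particle goes round the circle within the duration of the
window and so must meet it; since the solution hardly changes along Euler
polygons, it was already small at the start ([small_on_window_small_before]).
Only polygons are followed, so no existence theorem for differential equations
is involved. *)

(** * Generalities on the real line *)

Section real_line.
Context {R : realType}.

Lemma periodic_int (T : Type) (g : R -> T) (P : R) : (forall x, g (x + P) = g x) ->
  forall (m : int) x, g (x + m%:~R * P) = g x.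
Proof.
move=> gP.
have gPn n x : g (x + n%:R * P) = g x.
  elim: n x => [|n IH] x; first by rewrite mul0r addr0.
  by rewrite -natr1 mulrDl mul1r addrA gP IH.
case=> n x; first exact: gPn.
by rewrite -[LHS](gPn n.+1); congr g; rewrite NegzE mulrNz; ring.
Qed.

Lemma period_representative (P a x : R) : 0 < P ->
  exists m : int, a <= x + m%:~R * P < a + P.
Proof.
move=> P0; exists (- Num.floor ((x - a) / P)).
have := floor_itv ((x - a) / P).
by rewrite ler_pdivlMr// ltr_pdivrMr// intrD mulrDl mulrNz mulNr; lra.
Qed.

Lemma closure_open_segment (a b w : R) : a < b -> a <= w <= b ->
  closure `]a, b[%classic w.
Proof.
move=> ab wab B /nbhs_ballP[e /= e0 eB].
pose d := Num.min (e / 2) ((b - a) / 4).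
have d0 : 0 < d by rewrite lt_min !divr_gt0//; lra.
have de : d <= e / 2 by rewrite ge_min lexx.
have db : d <= (b - a) / 4 by rewrite ge_min lexx orbT.
have [wm|wm] := ltP w ((a + b) / 2).
  exists (w + d); split; first by rewrite /= in_itv /=; lra.
  by apply: eB; rewrite /ball /= ltr_norml; lra.
exists (w - d); split; first by rewrite /= in_itv /=; lra.
by apply: eB; rewrite /ball /= ltr_norml; lra.
Qed.

Lemma closed_le_norm (g : R -> R) (eps : R) : continuous g ->
  closed [set x | `|g x| <= eps].
Proof.
move=> cg; rewrite (_ : [set _ | _] = (fun x => `|g x|) @^-1` [set y | y <= eps])//.
apply: closed_comp; last exact: closed_le.
by move=> x _; apply: continuous_comp; [exact: cg|exact: norm_continuous].
Qed.

Lemma gaussian_decay_small (g : R -> R) (eps : R) : 0 < eps ->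
  (exists C : R, (\forall v \near +oo, `|g v| <= C * expR (- (v ^+ 2 / 2))) /\
                 (\forall v \near -oo, `|g v| <= C * expR (- (v ^+ 2 / 2)))) ->
  exists M : nat, forall v, M%:R <= `|v| -> `|g v| <= eps.
Proof.
move=> eps0 [C [[A [_ hA]] [B [_ hB]]]].
pose m := Num.max 1 (Num.max (2 * `|C| / eps) (Num.max (A + 1) (1 - B))).
exists (Num.truncn m).+1 => v Mv.
have : m < `|v| by apply: lt_le_trans Mv; exact: truncnS_gt.
rewrite /m !gt_max => /and4P[v1 vC vA vB].
have : `|g v| <= C * expR (- (v ^+ 2 / 2)).
  have [v0|v0] := leP 0 v; [apply: hA|apply: hB].
    by rewrite ger0_norm// in vA; lra.
  by rewrite ltr0_norm// in vB; lra.
move=> /le_trans; apply.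
have y0 : 0 < v ^+ 2 / 2 by rewrite divr_gt0// -real_normK ?num_real// exprn_gt0//; lra.
rewrite expRN ler_pdivrMr ?expR_gt0//.
apply: (@le_trans _ _ (eps * (1 + v ^+ 2 / 2))); last first.
  by rewrite ler_pM2l// expR_ge1Dx.
apply: (le_trans (ler_norm C)).
have vv : `|v| <= v ^+ 2 by rewrite -real_normK ?num_real// expr2 ler_peMl//; lra.
rewrite ltr_pdivrMr// in vC.
have : eps * `|v| <= eps * v ^+ 2 by rewrite ler_pM2l.
by lra.
Qed.

(** Baire's theorem localised to a segment and to a countable index type; it is
applied to closed sets that do not cover the whole line. *)
Lemma baire_segment (I : countType) (A : I -> set R) (a b : R) : a < b ->
  (forall i, closed (A i)) -> (forall x, a < x < b -> exists i, A i x) ->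
  exists i c d, [/\ a < c, c < d, d < b & forall x, c <= x <= d -> A i x].
Proof.
(* If no A i contains a segment then the complements below are dense. *)
move=> ab cA covA; apply: contrapT => noseg.
pose U (i : I) := ~` (A i `&` `[a, b]).
pose F n := if unpickle n is Some i then U i else [set: R].
have : dense (\bigcap_n F n).
  apply: Baire => n; rewrite /F; case: unpickle => [i|]; last first.
    by split; [exact: openT|move=> O O0 _; rewrite setIT].
  split; first by apply: closed_openC; apply: closedI => //; exact: itv_closed.
  move=> O [y Oy] oO; apply: contrapT => OU; apply: noseg.
  have /nbhs_ballP[e /= e0 eO] : nbhs y O by exact: open_nbhs_nbhs.
  have inA x : ball y e x -> (A i `&` `[a, b]) x.
    by move=> /eO Ox; apply: contrapT => nA; apply: OU; exists x.
  have bE x : ball y e x = (`|y - x| < e) by [].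
  exists i, (y - e / 4), (y + e / 4).
  have /inA[_ /=] : ball y e (y - e / 2) by rewrite bE ltr_norml; lra.
  have /inA[_ /=] : ball y e (y + e / 2) by rewrite bE ltr_norml; lra.
  rewrite !in_itv /= => /andP[? ?] /andP[? ?].
  split; [lra|lra|lra|] => x xy.
  by have /inA[] : ball y e x by rewrite bE ltr_norml; lra.
move=> /(_ `]a, b[%classic) [].
- by exists ((a + b) / 2); rewrite /= in_itv /=; lra.
- exact: itv_open.
- move=> x [/=]; rewrite in_itv /= => axb.
  have [i Aix] := covA x axb.
  move=> /(_ (pickle i) Logic.I); rewrite /F pickleK; apply; split => //=.
  by rewrite in_itv /=; lra.
Qed.

(** A sequence that advances by at least [d] and at most [r] per step, and
travels a full period, comes within [r] of every point modulo the period: the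
first term beyond a suitable representative of [c] overshoots it by at most one
step. *)
Lemma small_steps_hit (P d r c : R) (N : nat) (u : nat -> R) : 0 < P -> 0 <= r ->
  (forall k, (k < N)%N -> d <= u k.+1 - u k <= r) -> P <= N%:R * d ->
  exists2 k, (k <= N)%N & exists m : int, `|u k - (c + m%:~R * P)| <= r.
Proof.
move=> P0 r0 du PNd.
have [m /andP[u0y yP]] := period_representative (u 0%N) c P0.
set y := c + _ in u0y yP.
have uk k : (k <= N)%N -> u 0%N + k%:R * d <= u k.
  elim: k => [|k IH] kN; first by rewrite mul0r addr0.
  by have := IH (ltnW kN); have := du _ kN; rewrite -natr1 mulrDl mul1r; lra.
have ex : exists k, y <= u k.
  by exists N; have := uk _ (leqnn N); lra.
have kN : (ex_minn ex <= N)%N.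
  by case: ex_minnP => k _; apply; have := uk _ (leqnn N); lra.
exists (ex_minn ex) => //; exists m; rewrite -/y.
move: kN; case: ex_minnP => -[|k] yk kmin kN.
  by rewrite ler_norml; lra.
have : u k < y by rewrite ltNge; apply/negP => /kmin; rewrite ltnn.
by have := du _ kN; rewrite ler_norml; lra.
Qed.

End real_line.

(** * Integrals over a periodic strip *)

Section strip_integrals.
Context {R : realType}.
Local Notation mu := (@lebesgue_measure R).

(** The product sigma-algebra contains the open sets of the plane because each of
them is a countable union of rational rectangles. *)
Lemma open_measurable_plane (A : set (R * R)) :
  open A -> measurable (A : set (measurableTypeR R * measurableTypeR R)).
Proof.
move=> oA.
pose B (q : rat * rat * rat * rat) : set (R * R) :=
  `]ratr q.1.1.1, ratr q.1.1.2[%classic `*` `]ratr q.1.2, ratr q.2[%classic.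
pose C q : set (measurableTypeR R * measurableTypeR R) :=
  if `[< B q `<=` A >] then B q else set0.
have -> : A = \bigcup_q C q.
  apply/seteqP; split => [[x y] Axy|z [q _]]; last first.
    by rewrite /C; case: asboolP => // BA /BA.
  have /nbhs_ballP[e /= e0 eA] : nbhs (x, y) A by exact: open_nbhs_nbhs.
  have Q (z : R) : exists q : rat * rat,
      [/\ ratr q.1 < z, z < ratr q.2, z - e < ratr q.1 & ratr q.2 < z + e].
    have [q1] : exists q, ratr q \in `]z - e, z[ by apply: rat_in_itvoo; lra.
    have [q2] : exists q, ratr q \in `]z, z + e[ by apply: rat_in_itvoo; lra.
    rewrite !in_itv /= => /andP[? ?] /andP[? ?].
    by exists (q1, q2).
  have [[a b] /= [ax xb ea be]] := Q x.
  have [[c d] /= [cy yd ec de]] := Q y.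
  exists (a, b, c, d) => //.
  rewrite /C; case: asboolP => [_|]; first by split; rewrite /= in_itv /= ?ax ?cy.
  case=> -[x' y'] [] /=; rewrite !in_itv /= => /andP[? ?] /andP[? ?].
  apply: eA; split => /=; rewrite /ball /= ltr_norml; lra.
apply: countable_bigcupT_measurable => [|q]; first exact: countableP.
rewrite /C; case: ifP => _; last exact: measurable0.
by apply: measurableX; exact: measurable_itv.
Qed.

Lemma lebesgue_shift (a : R) (A : set R) : measurable A ->
  pushforward mu ((fun x => x + a) : _ -> measurableTypeR R) A = mu A.
Proof.
have ms : measurable_fun [set: measurableTypeR R]
    ((fun x => x + a) : measurableTypeR R -> measurableTypeR R).
  exact: measurable_funD.
move=> mA; apply/esym/lebesgue_measure_unique => //= _ [[b c]] _ <-.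
rewrite /pushforward.
rewrite (_ : _ @^-1` _ = `](b - a), (c - a)]%classic); last first.
  by apply/seteqP; split => x /=; rewrite !in_itv /= => /andP[xa xb]; apply/andP; split; lra.
rewrite !lebesgue_measure_itv/= !lte_fin.
have -> : (b - a < c - a) = (b < c) by apply/idP/idP; lra.
by case: ifP => // _; rewrite -!EFinB; congr (_%:E); lra.
Qed.

Lemma ge0_integral_shift (a : R) (f : R -> \bar R) (D : set R) :
  measurable D -> measurable_fun setT f -> (forall x, (0 <= f x)%E) ->
  (\int[mu]_(x in (fun x => (x + a)%R) @^-1` D) f (x + a)%R =
   \int[mu]_(x in D) f x)%E.
Proof.
move=> mD mf f0.
have ms : measurable_fun [set: measurableTypeR R]
    ((fun x => x + a) : measurableTypeR R -> measurableTypeR R).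
  exact: measurable_funD.
rewrite -(@ge0_integral_pushforward _ _ (measurableTypeR R) (measurableTypeR R)
  _ _ ms mu D f)//=; last exact: measurable_funTS.
by apply: eq_measure_integral => //= A mA AS; exact/lebesgue_shift.
Qed.

(** Reduce the shift modulo the period to some [r] in [0, P); the piece of the
shifted interval sticking out beyond [P] is brought back by periodicity. *)
Lemma ge0_integral_periodic_shift (P a : R) (f : R -> \bar R) : 0 < P ->
  measurable_fun setT f -> (forall x, (0 <= f x)%E) ->
  (forall x, f (x + P) = f x) ->
  (\int[mu]_(x in `[0%R, P[) f (x + a)%R = \int[mu]_(x in `[0%R, P[) f x)%E.
Proof.
move=> P0 mf f0 fP.
have [m am] := period_representative 0 a P0; pose r := a + m%:~R * P.
have rP : 0 <= r < P by rewrite /r; lra.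
transitivity (\int[mu]_(x in `[0%R, P[) f (x + r)%R)%E.
  by apply: eq_integral => x _; rewrite /r addrA (periodic_int fP).
have -> : `[0, P[%classic = (fun x => (x + r)) @^-1` `[r, P + r[%classic.
  by apply/seteqP; split => x /=; rewrite !in_itv /=; lra.
rewrite ge0_integral_shift//.
rewrite (_ : (fun x => x + r) @^-1` _ = `[0, P[%classic); last first.
  by apply/seteqP; split => x /=; rewrite !in_itv /=; lra.
have -> : `[r, P + r[%classic = `[r, P[%classic `|` `[P, P + r[%classic :> set R.
  apply/seteqP; split => x /=; rewrite !in_itv /=; last by move=> []; lra.
  by case: (ltP x P) => ? ?; [left|right]; lra.
have -> : `[0, P[%classic = `[r, P[%classic `|` `[0, r[%classic :> set R.
  apply/seteqP; split => x /=; rewrite !in_itv /=; last by move=> []; lra.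
  by case: (ltP x r) => ? ?; [right|left]; lra.
rewrite !ge0_integral_setU//; try exact: measurable_funTS; last 2 first.
- by apply/disj_setPS => x []; rewrite /= !in_itv /=; lra.
- by apply/disj_setPS => x []; rewrite /= !in_itv /=; lra.
congr (_ + _)%E.
rewrite -(@ge0_integral_shift P)//.
rewrite (_ : (fun x => x + P) @^-1` _ = `[0, r[%classic); last first.
  by apply/seteqP; split => x /=; rewrite !in_itv /=; lra.
by apply: eq_integral => x _.
Qed.

Lemma ge0_strip_integral1 (D : set R) (phi : R * R -> \bar R) : measurable D ->
  measurable_fun setT phi -> (forall z, (0 <= phi z)%E) ->
  (\int[mu \x mu]_(z in D `*` setT) phi z =
   \int[mu]_(x in D) \int[mu]_v phi (x, v))%E.
Proof.
move=> mD mphi phi0.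
have mDT : measurable (D `*` [set: R]) by exact: measurableX.
rewrite integral_mkcond fubini_tonelli1; last 2 first.
- by apply/(measurable_restrictT _ mDT); exact: measurable_funTS.
- by apply: erestrict_ge0 => //.
rewrite [RHS]integral_mkcond; apply: eq_integral => x _.
rewrite /fubini_F /patch; case: ifPn => xD.
  by apply: eq_integral => v _; rewrite mem_set//=; split => //; exact: set_mem.
rewrite integral0_eq// => v _; rewrite memNset// => -[/= /mem_set].
by move: xD => /negP.
Qed.

Lemma ge0_strip_integral2 (D : set R) (phi : R * R -> \bar R) : measurable D ->
  measurable_fun setT phi -> (forall z, (0 <= phi z)%E) ->
  (\int[mu \x mu]_(z in D `*` setT) phi z =
   \int[mu]_v \int[mu]_(x in D) phi (x, v))%E.
Proof.
move=> mD mphi phi0.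
have mDT : measurable (D `*` [set: R]) by exact: measurableX.
rewrite integral_mkcond fubini_tonelli2; last 2 first.
- by apply/(measurable_restrictT _ mDT); exact: measurable_funTS.
- by apply: erestrict_ge0 => //.
apply: eq_integral => v _.
rewrite [RHS]integral_mkcond; apply: eq_integral => x _.
rewrite /= /patch; case: ifPn => xD.
  by rewrite (_ : x \in D = true)//; apply/mem_set; move/set_mem : xD => [].
rewrite ifF//; apply/negbTE/negP => /set_mem Dx; move/negP : xD; apply.
by apply/mem_set; split.
Qed.

(** One step of the symplectic Euler scheme for x' = v, v' = - e x. The field is
taken at the new position, which makes the step a product of two shears. *)
Definition euler_step (h : R) (e : R -> R) (z : R * R) : R * R :=
  (z.1 + h * z.2, z.2 - h * e (z.1 + h * z.2)).

(** Tonelli's theorem allows the shear in x to be undone for each fixed [v], where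
it is a translation of a periodic function, and then the shear in v for each fixed
[x]. *)
Lemma ge0_integral_euler_step (P h : R) (g : R * R -> \bar R) (e : R -> R) : 0 < P ->
  measurable_fun setT g -> (forall z, (0 <= g z)%E) ->
  (forall x v, g (x + P, v) = g (x, v)) ->
  measurable_fun setT e -> (forall x, e (x + P) = e x) ->
  (\int[mu \x mu]_(z in `[0%R, P[ `*` setT)
     g (euler_step h e z) =
   \int[mu \x mu]_(z in `[0%R, P[ `*` setT) g z)%E.
Proof.
move=> P0 mg g0 gP me eP.
pose k (z : R * R) := g (z.1, z.2 - h * e z.1).
have mk : measurable_fun setT k.
  apply: measurableT_comp => //; apply: measurable_fun_pair => //.
  apply: measurable_funB => //; apply: measurable_funM => //.
  exact: measurableT_comp.
have k0 z : (0 <= k z)%E by exact: g0.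
pose k1 (z : R * R) := k (z.1 + h * z.2, z.2).
transitivity (\int[mu \x mu]_(z in `[0%R, P[ `*` setT) k1 z)%E => //.
have mk1 : measurable_fun setT k1.
  apply: measurableT_comp => //; apply: measurable_fun_pair => //.
  by apply: measurable_funD => //; exact: measurable_funM.
have k10 z : (0 <= k1 z)%E by exact: k0.
rewrite ge0_strip_integral2//=.
transitivity (\int[mu]_v \int[mu]_(x in `[0%R, P[) k (x, v))%E.
  apply: eq_integral => v _.
  rewrite (@ge0_integral_periodic_shift P (h * v) (fun x => k (x, v)))//.
    by apply: measurableT_comp mk _; exact: measurable_fun_pair.
  by move=> x; rewrite /k /= eP gP.
rewrite -ge0_strip_integral2// !ge0_strip_integral1//.
apply: eq_integral => x _.
rewrite -(@ge0_integral_shift (- (h * e x)) (fun v => g (x, v)) setT)//.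
by apply: measurableT_comp mg _; exact: measurable_fun_pair.
Qed.

Lemma strip_integral_support (P a b : R) (phi : R * R -> \bar R) :
  (forall z, ~~ (a <= z.2 <= b) -> phi z = 0%E) ->
  (\int[mu \x mu]_(z in `[0%R, P[ `*` setT) phi z =
   \int[mu \x mu]_(z in `[0%R, P[ `*` `[a, b]) phi z)%E.
Proof.
move=> phi0; rewrite integral_mkcond [RHS]integral_mkcond.
apply: eq_integral => -[x v] _; rewrite /patch.
have [[/= Px Pv]|nP] := pselect ((`[0%R, P[ `*` `[a, b]) (x, v)).
  by rewrite !mem_set.
rewrite [in RHS]memNset//; case: ifPn => // /set_mem[/= Px _].
by apply: phi0 => /=; apply/negP => avb; apply: nP; split.
Qed.

Lemma rectangle_measure (P a b : R) : 0 < P -> a < b ->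
  (mu \x mu)%E (`[0%R, P[ `*` `[a, b]) = (P * (b - a))%:E.
Proof.
move=> P0 ab; rewrite product_measure1E//= !lebesgue_measure_itv/= !lte_fin.
by rewrite P0 ab -!EFinB -EFinM subr0.
Qed.

Lemma strip_integral_le (P a b c : R) (g1 g2 : R * R -> R) : 0 < P -> a < b ->
  measurable_fun setT g1 -> measurable_fun setT g2 ->
  (forall z, 0 <= g1 z) -> (forall z, 0 <= g2 z) ->
  (forall z, ~~ (a <= z.2 <= b) -> g1 z = 0) ->
  (forall z, ~~ (a <= z.2 <= b) -> g2 z = 0) ->
  0 <= c -> (forall z, a <= z.2 <= b -> g1 z <= g2 z + c) ->
  (\int[mu \x mu]_(z in `[0%R, P[ `*` setT) (g1 z)%:E <=
   \int[mu \x mu]_(z in `[0%R, P[ `*` setT) (g2 z)%:E + (c * (P * (b - a)))%:E)%E.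
Proof.
move=> P0 ab mg1 mg2 g10 g20 s1 s2 c0 le12.
have mr : measurable (`[0%R, P[ `*` `[a, b] : set (measurableTypeR R * measurableTypeR R)).
  by apply: measurableX; exact: measurable_itv.
have mE (g : R * R -> R) : measurable_fun setT g ->
    measurable_fun (`[0%R, P[ `*` `[a, b]) (EFin \o g).
  by move=> mg; apply: measurable_funTS; exact/measurable_EFinP.
rewrite !(@strip_integral_support P a b); last 2 first.
- by move=> z /s2 ->.
- by move=> z /s1 ->.
rewrite EFinM -(rectangle_measure P0 ab) -integral_cst//.
rewrite -ge0_integralD//; [|by move=> z _; rewrite lee_fin|exact: mE].
apply: ge0_le_integral => //.
- by move=> z _; rewrite lee_fin.
- exact: mE.
- by apply: emeasurable_funD; [exact: mE|exact: measurable_cst].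
- move=> z [_ /=]; rewrite in_itv /= => zab.
  by rewrite -EFinD lee_fin; exact: le12.
Qed.

Lemma strip_integral_lty (P a b B : R) (g : R * R -> R) : 0 < P -> a < b ->
  measurable_fun setT g -> (forall z, 0 <= g z <= B) ->
  (forall z, ~~ (a <= z.2 <= b) -> g z = 0) ->
  (\int[mu \x mu]_(z in `[0%R, P[ `*` setT) (g z)%:E < +oo)%E.
Proof.
move=> P0 ab mg gB gs.
have B0 : 0 <= B by have /andP[] := gB (0, 0); exact: le_trans.
have g0 z : 0 <= g z by have /andP[] := gB z.
have le0 z : a <= z.2 <= b -> g z <= cst 0 z + B by move=> _ /=; rewrite add0r; case/andP: (gB z).
have m0 : measurable_fun setT (cst 0 : R * R -> R) by exact: measurable_cst.
have := strip_integral_le P0 ab mg m0 g0 (fun=> lexx 0) gs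
  (fun _ _ => erefl) B0 le0.
move=> /le_lt_trans; apply.
by rewrite integral0 add0e ltry.
Qed.

(** Integrals are compared through pointwise bounds on a rectangle of finite area,
which is where the common support in velocity matters. *)
Lemma strip_integral_close (P a b B c : R) (g1 g2 : R * R -> R) : 0 < P -> a < b ->
  measurable_fun setT g1 -> measurable_fun setT g2 ->
  (forall z, 0 <= g1 z <= B) -> (forall z, 0 <= g2 z <= B) ->
  (forall z, ~~ (a <= z.2 <= b) -> g1 z = 0) ->
  (forall z, ~~ (a <= z.2 <= b) -> g2 z = 0) ->
  0 <= c -> (forall z, a <= z.2 <= b -> g1 z <= g2 z + c) ->
  (forall z, a <= z.2 <= b -> g2 z <= g1 z + c) ->
  `|fine (\int[mu \x mu]_(z in `[0%R, P[ `*` setT) (g1 z)%:E)%E -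
    fine (\int[mu \x mu]_(z in `[0%R, P[ `*` setT) (g2 z)%:E)%E| <=
  c * (P * (b - a)).
Proof.
move=> P0 ab m1 m2 b1 b2 s1 s2 c0 le12 le21.
have g10 z : 0 <= g1 z by have /andP[] := b1 z.
have g20 z : 0 <= g2 z by have /andP[] := b2 z.
have f1 := strip_integral_lty P0 ab m1 b1 s1.
have f2 := strip_integral_lty P0 ab m2 b2 s2.
have := strip_integral_le P0 ab m1 m2 g10 g20 s1 s2 c0 le12.
have := strip_integral_le P0 ab m2 m1 g20 g10 s2 s1 c0 le21.
have fin (g : R * R -> R) : (forall z, 0 <= g z) ->
    (\int[mu \x mu]_(z in `[0%R, P[ `*` setT) (g z)%:E < +oo)%E ->
    (\int[mu \x mu]_(z in `[0%R, P[ `*` setT) (g z)%:E)%E \is a fin_num.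
  by move=> g0 gy; rewrite ge0_fin_numE// integral_ge0// => z _; rewrite lee_fin.
move: (fin _ g10 f1) (fin _ g20 f2).
move: (\int[mu \x mu]_(z in _) (g1 z)%:E)%E (\int[mu \x mu]_(z in _) (g2 z)%:E)%E.
move=> [r1| |] [r2| |] //= _ _; rewrite -!EFinD !lee_fin ler_norml => ? ?.
by apply/andP; split; lra.
Qed.

End strip_integrals.

(** * The transport equation as invariance under small Euler steps *)

Section local_step.
Context {R : realType}.

(** The two endpoints are in no particular order, and the intermediate point is
only located in the ball: this is the form needed to move along one coordinate
inside a box. *)
Lemma mvt_ball (g : R -> R) (c r u w : R) :
  (forall y, ball c r y -> derivable g y 1) -> ball c r u -> ball c r w ->
  exists2 y, ball c r y & g w - g u = derive1 g y * (w - u).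
Proof.
wlog uw : u w / u <= w => [hw gd bu bw|].
  have [uw|/ltW wu] := leP u w; first exact: hw.
  have [y by_ e] := hw _ _ wu gd bw bu.
  by exists y => //; rewrite -opprB e -mulrN opprB.
move=> gd bu bw.
have sub y : u <= y <= w -> ball c r y.
  by move: bu bw; rewrite /ball /= !ltr_norml; lra.
have dg y : y \in `]u, w[ -> is_derive y 1 g (derive1 g y).
  rewrite in_itv /= => /andP[/ltW uy /ltW yw].
  by rewrite derive1E; apply/derivableP/gd/sub; rewrite uy yw.
have cg : {within `[u, w], continuous g}.
  apply: derivable_within_continuous => y; rewrite in_itv /= => yuw.
  exact/gd/sub.
have [y yuw e] := MVT_segment uw dg cg.
by exists y => //; apply: sub; move: yuw; rewrite in_itv.
Qed.

(** The increment is split into three moves, one along each coordinate. By the mean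
value theorem each contributes a partial derivative at a point near (x0, v0, t0),
and up to o(h) the total is [h] times the left-hand side of the Vlasov equation at
(x0, v0, t0). The bound holds uniformly for starting points near (x0, v0, t0), so
that compactness applies. *)
Lemma transport_step_near (D : set (R * R * R)) (f : R -> R -> R -> R)
    (E : R -> R -> R) (x0 v0 t0 eta : R) :
  open D -> C1_on D f -> D (x0, v0, t0) ->
  {for (x0, t0), continuous (fun p : R * R => E p.1 p.2)} ->
  dt f x0 v0 t0 + v0 * dx f x0 v0 t0 - E x0 t0 * dv f x0 v0 t0 = 0 ->
  0 < eta ->
  \forall p \near (x0, v0, t0) & h \near (0 : R),
    [/\ D p, D (euler_step h (E ^~ p.2) p.1, p.2 + h) &
      `|uncurry3 f (euler_step h (E ^~ p.2) p.1, p.2 + h) - uncurry3 f p|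
        <= eta * `|h|].
Proof.
move=> oD fC1 D0 E0 vlasov eta0.
have [[dxf dvf dtf] [cx cv ct]] := fC1 _ _ _ D0.
set a := dx f x0 v0 t0 in vlasov; set b := dv f x0 v0 t0 in vlasov.
set c := dt f x0 v0 t0 in vlasov; set e0 := E x0 t0 in vlasov.
(* If the partial derivatives, v and E are within d <= 1 of their values at
   (x0, v0, t0), the error on v * a - e * b + c is at most d * S. *)
pose S : R := `|v0| + 1 + `|a| + (`|e0| + 1 + `|b|) + 1.
have S0 : 0 < S by rewrite /S; do !(apply: addr_gt0 || apply: ltr_wpDl || apply: ltr_wpDr) => //.
pose d := Num.min 1 (eta / S).
have d0 : 0 < d by rewrite /d lt_min ltr01 divr_gt0.
have d1 : d <= 1 by rewrite /d ge_min lexx.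
have dS : d * S <= eta by rewrite -ler_pdivlMr// /d ge_min lexx orbT.
have /nbhs_ballP[r /= r0 rS] : \forall p \near (x0, v0, t0),
  [/\ D p, `|a - uncurry3 (dx f) p| < d, `|b - uncurry3 (dv f) p| < d &
           `|c - uncurry3 (dt f) p| < d].
  have nD : nbhs (x0, v0, t0) D by exact: open_nbhs_nbhs.
  move/cvgrPdist_lt : cx => /(_ _ d0) nx; move/cvgrPdist_lt : cv => /(_ _ d0) nv.
  move/cvgrPdist_lt : ct => /(_ _ d0) nt.
  by apply: filterS (filterI nD (filterI nx (filterI nv nt))) => p [? [? []]].
pose F := nbhs ((x0, v0, t0), (0 : R)).
have cvh : q.2 @[q --> F] --> (0 : R) by exact: cvg_snd.
have cvp : q.1 @[q --> F] --> (x0, v0, t0) by exact: cvg_fst.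
have cvt : q.1.2 @[q --> F] --> t0.
  by apply: (cvg_comp _ _ cvp); exact: cvg_snd.
have cvxv : q.1.1 @[q --> F] --> (x0, v0).
  by apply: (cvg_comp _ _ cvp); exact: cvg_fst.
have cvx : q.1.1.1 @[q --> F] --> x0.
  by apply: (cvg_comp _ _ cvxv); exact: cvg_fst.
have cvv : q.1.1.2 @[q --> F] --> v0.
  by apply: (cvg_comp _ _ cvxv); exact: cvg_snd.
have cvx' : q.1.1.1 + q.2 * q.1.1.2 @[q --> F] --> x0.
  by rewrite -[X in _ --> X]addr0 -(mul0r v0); apply: cvgD => //; exact: cvgM.
have cvE : E (q.1.1.1 + q.2 * q.1.1.2) q.1.2 @[q --> F] --> e0.
  exact: (cvg_comp _ _ (cvg_pair cvx' cvt) E0).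
have cvv' : q.1.1.2 - q.2 * E (q.1.1.1 + q.2 * q.1.1.2) q.1.2 @[q --> F] --> v0.
  by rewrite -[X in _ --> X]subr0 -(mul0r e0); apply: cvgB => //; exact: cvgM.
have cvt' : q.1.2 + q.2 @[q --> F] --> t0.
  by rewrite -[X in _ --> X]addr0; exact: cvgD.
suff : \forall q \near F,
  [/\ D q.1, D (euler_step q.2 (E ^~ q.1.2) q.1.1, q.1.2 + q.2) &
   `|uncurry3 f (euler_step q.2 (E ^~ q.1.2) q.1.1, q.1.2 + q.2) - uncurry3 f q.1|
      <= eta * `|q.2|] by [].
near=> q.
have bx : ball x0 r q.1.1.1 by near: q; exact: (cvg_ball cvx).
have bv : ball v0 r q.1.1.2 by near: q; exact: (cvg_ball cvv).
have bt : ball t0 r q.1.2 by near: q; exact: (cvg_ball cvt).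
have bx' : ball x0 r (q.1.1.1 + q.2 * q.1.1.2) by near: q; exact: (cvg_ball cvx').
have bv' : ball v0 r (q.1.1.2 - q.2 * E (q.1.1.1 + q.2 * q.1.1.2) q.1.2).
  by near: q; exact: (cvg_ball cvv').
have bt' : ball t0 r (q.1.2 + q.2) by near: q; exact: (cvg_ball cvt').
have dv0 : ball v0 d q.1.1.2 by near: q; exact: (cvg_ball cvv).
have de0 : ball e0 d (E (q.1.1.1 + q.2 * q.1.1.2) q.1.2).
  by near: q; exact: (cvg_ball cvE).
clear - rS bx bv bt bx' bv' bt' dv0 de0 vlasov dS d0 d1 fC1.
case: q => -[[x v] t] h /= in bx bv bt bx' bv' bt' dv0 de0 *.
rewrite /uncurry3 /euler_step /=.
set x' := x + h * v in bx' bv' de0 *; set e := E x' t in bv' de0 *.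
set v' := v - h * e in bv' *; set t' := t + h in bt' *.
have bS y w s : ball x0 r y -> ball v0 r w -> ball t0 r s -> ball (x0, v0, t0) r (y, w, s).
  by move=> *; split.
split; [by have [] := rS _ (bS _ _ _ bx bv bt)|
        by have [] := rS _ (bS _ _ _ bx' bv' bt')|].
have gx y : ball x0 r y -> derivable (fun y => f y v' t') y 1.
  by move=> b1; have [/fC1[[]]] := rS _ (bS _ _ _ b1 bv' bt').
have gv w : ball v0 r w -> derivable (fun w => f x w t') w 1.
  by move=> b1; have [/fC1[[]]] := rS _ (bS _ _ _ bx b1 bt').
have gt s : ball t0 r s -> derivable (fun s => f x v s) s 1.
  by move=> b1; have [/fC1[[]]] := rS _ (bS _ _ _ bx bv b1).
have [y by1 ey] := mvt_ball gx bx bx'.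
have [w bw ew] := mvt_ball gv bv bv'.
have [s bs es] := mvt_ball gt bt bt'.
have [_ + _ _] := rS _ (bS _ _ _ by1 bv' bt').
have [_ _ + _] := rS _ (bS _ _ _ bx bw bt').
have [_ _ _ +] := rS _ (bS _ _ _ bx bv bs).
rewrite /uncurry3 /= /dx /dv /dt.
move: ey ew es; set al := derive1 _ y; set be := derive1 _ w; set ga := derive1 _ s.
move=> ey ew es hga hbe hal.
have -> : f x' v' t' - f x v t = h * (al * v - be * e + ga).
  transitivity ((f x' v' t' - f x v' t') + (f x v' t' - f x v t') + (f x v t' - f x v t)).
    by ring.
  by rewrite ey ew es /x' /v' /t'; ring.
rewrite normrM mulrC ler_wpM2r//; apply: le_trans dS.
have -> : al * v - be * e + ga = - (a - al) * v - a * (v0 - v) + (b - be) * e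
    + b * (e0 - e) - (c - ga) by rewrite -[LHS]subr0 -vlasov; ring.
have vb : `|v| <= `|v0| + 1.
  by rewrite -[v](subKr v0) (le_trans (ler_normB _ _))// lerD2l (le_trans (ltW dv0)).
have eb : `|e| <= `|e0| + 1.
  by rewrite -[e](subKr e0) (le_trans (ler_normB _ _))// lerD2l (le_trans (ltW de0)).
have -> : d * S = d * (`|v0| + 1) + d * `|a| + d * (`|e0| + 1) + d * `|b| + d.
  by rewrite /S; ring.
apply: (le_trans (ler_normB _ _)); apply: lerD; last exact: ltW.
apply: (le_trans (ler_normD _ _)); apply: lerD; last first.
  by rewrite normrM mulrC ler_wpM2r// ltW.
apply: (le_trans (ler_normD _ _)); apply: lerD; last first.
  by rewrite normrM ler_pM// ltW.
apply: (le_trans (ler_normB _ _)); apply: lerD; last first.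
  by rewrite normrM mulrC ler_wpM2r// ltW.
by rewrite normrM normrN ler_pM// ltW.
Unshelve. all: by end_near. Qed.
End local_step.

(** * First consequences for a solution *)

Section solution.
Context {R : realType}.
Variables (T : R) (Omega_v : set R) (f0 : R -> R -> R) (f : R -> R -> R -> R).
Variable E : R -> R -> R.
Hypothesis hf : vlasov_poisson_solution T Omega_v f0 f E.
Local Notation P := (2 * pi : R).

Lemma period_gt0 : 0 < P. Proof. by rewrite mulr_gt0// pi_gt0. Qed.

(** Extending by zero in [v] makes the truncated squares functions on the whole
strip, on which [euler_step] acts, for bounded and unbounded velocities alike. *)
Definition zero_ext x v t : R := if v \in Omega_v then f x v t else 0.
Local Notation F := zero_ext.

Lemma velocity_open : open Omega_v.
Proof.
case: (vp_velocity hf) => [[a [b [_ -> _]]]|[-> _]]; last exact: openT.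
exact: itv_open.
Qed.

Lemma interior_open : open [set p : R * R * R | Omega_v p.1.2 /\ 0 < p.2 < T].
Proof.
rewrite openE => -[[x v] t] [/= Ov tT].
have nv : \forall w \near v, Omega_v w.
  by apply: open_nbhs_nbhs; split => //; exact: velocity_open.
have nt : \forall s \near t, s \in `]0, T[ by apply: near_in_itvoo; rewrite in_itv.
rewrite /interior.
have cvv : p.1.2 @[p --> (x, v, t)] --> v.
  apply: (@cvg_comp _ _ _ fst snd (nbhs (x, v, t)) (nbhs (x, v)) (nbhs v)).
    exact: cvg_fst.
  exact: cvg_snd.
have cvt : p.2 @[p --> (x, v, t)] --> t by exact: cvg_snd.
move: (cvv _ nv) (cvt _ nt) => nv' nt'.
near=> p; split; first by near: p.
suff : p.2 \in `]0, T[ by rewrite in_itv.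
by near: p.
Unshelve. all: by end_near. Qed.

Lemma E_continuous_interior x t : 0 < t < T ->
  {for (x, t), continuous (fun p : R * R => E p.1 p.2)}.
Proof.
move=> tT.
have nt : \forall s \near t, s \in `]0, T[ by apply: near_in_itvoo; rewrite in_itv.
have cvt : p.2 @[p --> (x, t)] --> t by exact: cvg_snd.
have tT' : 0 <= t < T by lra.
have /subspace_continuousP/(_ (x, t) tT') := vp_E_continuous hf.
rewrite within_interior// /interior.
move: (cvt _ nt) => nt'.
near=> p => /=.
suff : p.2 \in `]0, T[ by rewrite in_itv/=; lra.
by near: p.
Unshelve. all: by end_near. Qed.

Lemma zero_ext_periodic x v t : 0 <= t < T -> F (x + P) v t = F x v t.
Proof.
move=> tT; rewrite /F; case: ifPn => // /set_mem Ov.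
by apply: (vp_f_periodic hf) => //; exact: subset_closure.
Qed.

Lemma E_bounded b : b < T -> exists2 K, 0 < K & forall x t, 0 <= t <= b -> `|E x t| <= K.
Proof.
move=> bT.
have cK : compact (`[0, P] `*` `[0, b] : set (R * R)).
  by apply: compact_setX; exact: segment_compact.
have /(continuous_compact) /(_ cK) : {within `[0, P] `*` `[0, b],
    continuous (fun p : R * R => E p.1 p.2)}.
  apply: continuous_subspaceW (vp_E_continuous hf) => -[x t] [/= _].
  by rewrite in_itv /=; lra.
move=> /compact_bounded[M [_ Mb]].
exists (Num.max 1 (M + 1)); first by rewrite lt_max ltr01.
move=> x t tb.
have [m xm] := period_representative 0 x period_gt0.
rewrite -(periodic_int (P := P) (g := E ^~ t) _ m) => [|y]; last first.
  by apply: (vp_E_periodic hf); lra.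
apply: (Mb (Num.max 1 (M + 1))); first by rewrite lt_max; apply/orP; right; lra.
exists (x + m%:~R * P, t) => //; split; rewrite /= in_itv //=; lra.
Qed.

(** The local estimate holds near each point of a compact box, hence for a common
[h] on all of it; periodicity removes the restriction on [x]. *)
Lemma transport_step_uniform (v1 v2 a b eta : R) : 0 < a -> b < T ->
  (forall v, v1 <= v <= v2 -> Omega_v v) -> 0 < eta ->
  \forall h \near (0 : R), forall x v t, v1 <= v <= v2 -> a <= t <= b ->
    `|uncurry3 F (euler_step h (E ^~ t) (x, v), t + h) - F x v t| <= eta * `|h|.
Proof.
move=> a0 bT vO eta0.
pose K : set (R * R * R) := `[0, P] `*` `[v1, v2] `*` `[a, b].
have cK : compact K.
  by apply: compact_setX; [apply: compact_setX|]; exact: segment_compact.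
pose Q h (p : R * R * R) := `|uncurry3 F (euler_step h (E ^~ p.2) p.1, p.2 + h)
      - uncurry3 F p| <= eta * `|h|.
have := @compact_near_coveringP _ K; move=> -[/(_ cK) covK _].
have {}covK := covK R (nbhs (0 : R)) Q _.
have : \forall h \near (0 : R), K `<=` Q h.
  apply: covK => -[[x0 v0] t0] [[/=]].
  rewrite !in_itv /= => _ /vO Ov0 t0ab.
  have t0T : 0 < t0 < T by lra.
  have := @transport_step_near _ _ _ E _ _ _ eta interior_open (vp_f_C1 hf)
    (conj Ov0 t0T) (E_continuous_interior t0T)
    (vp_vlasov hf x0 Ov0 t0T) eta0.
  apply: filterS => -[[[x v] t] h] /= [[Ov tT] [Ov' tT']].
  by rewrite /Q /uncurry3 /F /= !mem_set.
move=> KQ.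
have nh : \forall h \near (0 : R), `|h| < Num.min a (T - b).
  have := @nbhs0_lt R R (Num.min a (T - b)).
  by apply; rewrite lt_min a0 subr_gt0.
near=> h => x v t vv tt.
have [m xm] := period_representative 0 x period_gt0.
have hT : 0 <= t + h < T.
  have : `|h| < Num.min a (T - b) by near: h.
  by rewrite lt_min !ltr_norml; lra.
have : Q h (x + m%:~R * P, v, t).
  suff : K `<=` Q h by apply; split; [split|] => /=; rewrite in_itv /=; lra.
  by near: h.
rewrite /Q /uncurry3 /euler_step /=.
rewrite (periodic_int (P := P) (g := fun x => F x v t)); last first.
  by move=> y; apply: zero_ext_periodic; lra.
rewrite addrAC (periodic_int (P := P) (g := E ^~ t)); last first.
  by move=> y; apply: (vp_E_periodic hf); lra.
rewrite (periodic_int (P := P) (g := fun x => F x _ (t + h)))//.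
by move=> y; exact: zero_ext_periodic.
Unshelve. all: by end_near. Qed.

End solution.

(** * Smallness far away in velocity *)

Section euler.
Context {R : realType}.
Variable E : R -> R -> R.

(** The field is frozen at the time of each step: [euler_polygon h t0 z0 k] is the
position reached at time [t0 + k * h]. *)
Fixpoint euler_polygon (h t0 : R) (z0 : R * R) (k : nat) : R * R :=
  if k is k'.+1 then
    euler_step h (E ^~ (t0 + k'%:R * h)) (euler_polygon h t0 z0 k')
  else z0.

(** The errors of the successive steps add up. The velocity bound serves to keep the
polygon in the region [`|v| <= W] where the one-step estimate is available. *)
Lemma euler_polygon_drift (G : R -> R -> R -> R) (W a b K eta h x0 v0 t0 : R) (N : nat) :
  0 <= K -> 0 <= h ->
  (forall x t, a <= t <= b -> `|E x t| <= K) ->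
  (forall x v t, `|v| <= W -> a <= t <= b ->
    `|uncurry3 G (euler_step h (E ^~ t) (x, v), t + h) - G x v t| <= eta * `|h|) ->
  a <= t0 -> t0 + N%:R * h <= b -> `|v0| + K * (N%:R * h) <= W ->
  forall k, (k <= N)%N ->
    `|(euler_polygon h t0 (x0, v0) k).2 - v0| <= K * (k%:R * h) /\
    `|uncurry3 G (euler_polygon h t0 (x0, v0) k, t0 + k%:R * h) - G x0 v0 t0|
       <= eta * (k%:R * h).
Proof.
move=> K0 h0 EK step at0 tNb vW; elim=> [_|k IH kN].
  by rewrite /uncurry3/= !mul0r !mulr0 addr0 !subrr normr0.
have [] := IH (ltnW kN); rewrite /=; set z := euler_polygon _ _ _ _; set t := t0 + _.
move=> zv0 zG.
have kNh : k.+1%:R * h <= N%:R * h by rewrite ler_wpM2r// ler_nat.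
have kh0 : 0 <= k%:R * h by rewrite mulr_ge0.
have tE : t0 + k.+1%:R * h = t + h by rewrite /t -natr1; ring.
have tab : a <= t <= b by rewrite /t; move: kNh; rewrite -natr1 mulrDl mul1r; lra.
have zW : `|z.2| <= W.
  apply: le_trans vW; rewrite -[z.2](subrK v0) addrC.
  rewrite (le_trans (ler_normD _ _))// lerD2l (le_trans zv0)//.
  rewrite ler_wpM2l//; move: kNh; rewrite -natr1 mulrDl mul1r; lra.
split.
  have -> : z.2 - h * E (z.1 + h * z.2) t - v0 = (z.2 - v0) - h * E (z.1 + h * z.2) t by ring.
  rewrite (le_trans (ler_normB _ _))// -natr1 mulrDl mul1r mulrDr lerD//.
  by rewrite normrM (ger0_norm h0) mulrC ler_wpM2r// EK.
have := step z.1 z.2 t zW tab; rewrite (ger0_norm h0) tE => stepz.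
rewrite -natr1 mulrDl mul1r mulrDr.
set y := uncurry3 G _.
have -> : y - G x0 v0 t0 = (uncurry3 G (z, t) - G x0 v0 t0) + (y - uncurry3 G (z, t)) by ring.
by apply: (le_trans (ler_normD _ _)); apply: lerD.
Qed.

End euler.

Section solution.
Context {R : realType}.
Variables (T : R) (Omega_v : set R) (f0 : R -> R -> R) (f : R -> R -> R -> R).
Variable E : R -> R -> R.
Hypothesis hf : vlasov_poisson_solution T Omega_v f0 f E.
Local Notation P := (2 * pi : R).
Local Notation F := (zero_ext Omega_v f).

(** A particle starting with a large velocity keeps it up to [K * T], so between
times [a] and [b] it covers a full period and its Euler polygon meets the window
around [c]. The accumulated error is at most [e], which is arbitrary. The polygon is
built in two parts, from [t0] to [a] and from [a] to [b], so that the second one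
starts exactly when the window opens. *)
Lemma small_on_window_small_before (M c r a b eps x0 v0 t0 K : R) :
  Omega_v = setT -> 0 < t0 -> t0 < a -> a < b -> b < T -> 0 < r -> 0 <= K ->
  (forall x t, 0 <= t <= b -> `|E x t| <= K) ->
  (forall x v t, `|x - c| <= r -> a <= t <= b -> M <= `|v| -> `|F x v t| <= eps) ->
  Num.max M (P / (b - a)) + K * T <= `|v0| -> `|F x0 v0 t0| <= eps.
Proof.
move=> OT t00 t0a ab bT r0 K0 EK small v0big; apply/ler_addgt0Pr => e e0.
have T0 : 0 < T by lra.
have KT0 : 0 <= K * T by rewrite mulr_ge0// ltW.
pose W : R := `|v0| + K * T + K * T.
have vO v : - W <= v <= W -> Omega_v v by rewrite OT.
have eT0 : 0 < e / T by rewrite divr_gt0.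
have /nbhs_ballP[d /= d0 step] := transport_step_uniform hf t00 bT vO eT0.
have W0 : 0 < W + 1 by rewrite /W; have := normr_ge0 v0; lra.
(* Steps shorter than m satisfy the one-step estimate, and at speed at most W they
   cannot jump over the window. *)
pose m := Num.min d (r / (W + 1)).
have m0 : 0 < m by rewrite /m lt_min d0 divr_gt0.
pose N := (Num.truncn (T / m)).+1.
have N0 : 0 < N%:R :> R by rewrite ltr0n.
have NT : T / N%:R < m.
  by rewrite ltr_pdivrMr// mulrC -ltr_pdivrMr// /N truncnS_gt.
have hm s : 0 < s < T -> 0 <= s / N%:R < m.
  move=> /andP[s0 sT]; rewrite divr_ge0 ?ltW//=.
  by apply: le_lt_trans NT; rewrite ler_pM2r ?invr_gt0// ltW.
have stepW h : 0 <= h < m -> forall x v t, `|v| <= W -> t0 <= t <= b ->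
  `|uncurry3 F (euler_step h (E ^~ t) (x, v), t + h) - F x v t| <= e / T * `|h|.
  move=> /andP[h0 hm'] x v t; rewrite ler_norml => vW tt; apply: step => //.
  rewrite /ball /= sub0r normrN ger0_norm//; apply: lt_le_trans hm' _.
  by rewrite /m ge_min lexx.
have EK' x t : t0 <= t <= b -> `|E x t| <= K by move=> ?; apply: EK; lra.
pose h1 := (a - t0) / N%:R; pose h2 := (b - a) / N%:R.
have h1m : 0 <= h1 < m by apply: hm; lra.
have h2m : 0 <= h2 < m by apply: hm; lra.
have Nh1 : N%:R * h1 = a - t0 by rewrite /h1 mulrC divfK// gt_eqF.
have Nh2 : N%:R * h2 = b - a by rewrite /h2 mulrC divfK// gt_eqF.
have [h10 _] := andP h1m; have [h20 h2lt] := andP h2m.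
have KaT : K * (a - t0) <= K * T by rewrite ler_wpM2l//; lra.
have KbT : K * (b - a) <= K * T by rewrite ler_wpM2l//; lra.
have e1 : t0 + N%:R * h1 <= b by rewrite Nh1; lra.
have w1 : `|v0| + K * (N%:R * h1) <= W by rewrite Nh1 /W; lra.
have [] := euler_polygon_drift x0 K0 h10 EK' (stepW _ h1m) (lexx _) e1 w1 (leqnn _).
set z1 := euler_polygon _ _ _ _ N => z1v z1F.
have w2 : `|z1.2| + K * (N%:R * h2) <= W.
  rewrite Nh2 /W lerD// -[z1.2](subrK v0) addrC.
  by rewrite (le_trans (ler_normD _ _))// lerD2l (le_trans z1v)// Nh1.
have e2 : a + N%:R * h2 <= b by rewrite Nh2; lra.
have t0a' : t0 <= a by exact: ltW.
have := euler_polygon_drift z1.1 K0 h20 EK' (stepW _ h2m) t0a' e2 w2.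
rewrite -surjective_pairing => drift2.
pose z2 := euler_polygon E h2 a z1.
have v0M : M + K * T <= `|v0|.
  by apply: le_trans v0big; rewrite lerD2r le_max lexx.
have v0P : P <= (b - a) * (`|v0| - K * T).
  rewrite [leRHS]mulrC -ler_pdivrMr ?subr_gt0// lerBrDr.
  by apply: le_trans v0big; rewrite lerD2r le_max lexx orbT.
have Kab : K * (a - t0) + K * (b - a) <= K * T by rewrite -mulrDr ler_wpM2l//; lra.
have z2v k : (k <= N)%N -> `|(z2 k).2 - v0| <= K * T.
  move=> kN; have [zv _] := drift2 _ kN.
  have kNh : K * (k%:R * h2) <= K * (b - a).
    by rewrite -Nh2 ler_wpM2l// ler_wpM2r// ler_nat.
  have -> : (z2 k).2 - v0 = ((z2 k).2 - z1.2) + (z1.2 - v0) by ring.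
  rewrite (le_trans (ler_normD _ _))//; rewrite Nh1 in z1v.
  by move: zv z1v; rewrite -/(z2 k); lra.
(* The sign of v0, which reduces leftward motion to rightward motion. *)
have [s [ss sv]] : exists s : R, s * s = 1 /\ s * v0 = `|v0|.
  by have [v0p|v0n] := leP 0 v0; [exists 1|exists (-1)];
    rewrite ?(ger0_norm v0p) ?(ltr0_norm v0n); split; ring.
have sn y : `|s * y| = `|y|.
  have s1 : `|s| = 1.
    by apply/eqP; rewrite -(@eqrXn2 _ 2)// expr1n -normrX expr2 ss normr1.
  by rewrite normrM s1 mul1r.
have v0KT : 0 <= `|v0| - K * T.
  have : 0 < (b - a) * (`|v0| - K * T) by apply: lt_le_trans v0P; exact: period_gt0.
  by rewrite pmulr_rgt0 ?subr_gt0// => /ltW; rewrite subr_ge0.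
have du k : (k < N)%N ->
    h2 * (`|v0| - K * T) <= s * (z2 k.+1).1 - s * (z2 k).1 <= r.
  move=> kN.
  have -> : s * (z2 k.+1).1 - s * (z2 k).1 = h2 * (s * (z2 k).2) by rewrite /=; ring.
  have : `|s * (z2 k).2 - `|v0| | <= K * T.
    by rewrite -sv -mulrBr sn; apply: z2v; exact: ltnW.
  rewrite ler_norml => svk.
  rewrite ler_wpM2l//=; last by lra.
  have rE : r = r / (W + 1) * (W + 1) by rewrite divfK// gt_eqF.
  rewrite [leRHS]rE; apply: ler_pM => //; first by lra.
    by apply: (le_trans (ltW h2lt)); rewrite /m ge_min lexx orbT.
  by rewrite /W; lra.
have PN : P <= N%:R * (h2 * (`|v0| - K * T)) by rewrite mulrA Nh2.
have [k kN [j hit]] := small_steps_hit (s * c) period_gt0 (ltW r0) du PN.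
have [i iE] : exists i : int, i%:~R * P = - (s * (j%:~R * P)).
  have /orP[/eqP ->|/eqP ->] : (s == 1) || (s == -1).
    by rewrite -eqf_sqr expr1n expr2 ss.
  - by exists (- j); rewrite mulrNz mulNr mul1r.
  - by exists j; rewrite mulN1r opprK.
have [zv zF] := drift2 _ kN.
have kh2 : 0 <= k%:R * h2 <= b - a.
  by rewrite mulr_ge0//= -Nh2 ler_wpM2r// ler_nat.
have Fz2 : `|uncurry3 F (z2 k, a + k%:R * h2)| <= eps.
  rewrite /uncurry3 /=.
  rewrite -(periodic_int (P := P) (g := fun x => F x _ _) _ i) => [|y]; last first.
    by apply: (zero_ext_periodic hf); lra.
  apply: small.
  - rewrite iE -sn.
    have -> : s * ((z2 k).1 - s * (j%:~R * P) - c) =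
      s * (z2 k).1 - (s * c + (s * s) * (j%:~R * P)) by ring.
    by rewrite ss mul1r.
  - by lra.
  - have : `|v0| - `|(z2 k).2| <= K * T.
      by apply: le_trans (z2v _ kN); rewrite distrC; exact: lerB_dist.
    by lra.
have eT : e / T * (N%:R * h1) + e / T * (k%:R * h2) <= e.
  have TE : e / T * T = e by rewrite divfK// gt_eqF.
  rewrite -mulrDr -[leRHS]TE ler_wpM2l//; first exact: ltW.
  by rewrite Nh1; lra.
have t0E : t0 + N%:R * h1 = a by rewrite Nh1; ring.
move: z1F zF Fz2; rewrite t0E -/(z2 k) /uncurry3 /=.
set A := F (z2 k).1 _ _; set B := F z1.1 _ _ => AB BC Aeps.
have -> : F x0 v0 t0 = A - (A - B) - (B - F x0 v0 t0) by ring.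
apply: (le_trans (ler_normB _ _)).
by have := ler_normB A (A - B); lra.
Qed.


(** Baire's theorem is used twice. For fixed [x] it gives a time interval, which may
be shrunk to a rational one, where smallness holds for all velocities beyond some
integer. There are countably many such intervals and integers, so a second
application, in [x], gives a common choice on a whole interval of positions. *)
Lemma small_window (t1 eps : R) : Omega_v = setT -> 0 <= t1 < T ->
  (forall x t, 0 <= t < T -> exists M : nat, forall v, M%:R <= `|v| -> `|f x v t| <= eps) ->
  exists M c r a b : R, [/\ t1 < a, a < b, b < T, 0 < r &
    forall x v t, `|x - c| <= r -> a <= t <= b -> M <= `|v| -> `|f x v t| <= eps].
Proof.
move=> OT t1T decay.
pose a := (2 * t1 + T) / 3; pose b := (t1 + 2 * T) / 3.
have [t1a ab bT] : [/\ t1 < a, a < b & b < T] by rewrite /a /b; split; lra.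
have cf x v t : 0 < t < T -> {for (x, v, t), continuous (uncurry3 f)}.
  move=> tT.
  have tT' : closure Omega_v v /\ 0 <= t < T.
    by split; [apply: subset_closure; rewrite OT|lra].
  have /subspace_continuousP/(_ (x, v, t) tT') := vp_f_continuous hf.
  rewrite within_interior//.
  have nI : nbhs (x, v, t) [set p : R * R * R | Omega_v p.1.2 /\ 0 < p.2 < T].
    by apply: open_nbhs_nbhs; split; [exact: (interior_open hf)|rewrite /= OT].
  apply: filterS nI => -[[y w] s] /= [Ow sT].
  by split; [exact: subset_closure|lra].
(* Clamping the time to [a, b] gives functions continuous on the whole line, hence
   sublevel sets that are closed. *)
pose cl t := Num.max a (Num.min b t).
have clE t : a <= t <= b -> cl t = t.
  by move=> /andP[at_ tb]; rewrite /cl (min_idPr tb) (max_idPr at_).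
have clT t : 0 < cl t < T.
  rewrite /cl lt_max gt_max gt_min; apply/andP; split; first by apply/orP; left; lra.
  by apply/andP; split; [|apply/orP; left]; lra.
have ccl : continuous cl.
  move=> t; apply: (@continuous_max _ _ (cst a) (fun t => Num.min b t)).
    exact: cst_continuous.
  by apply: (@continuous_min _ _ (cst b) id) => //; exact: cst_continuous.
have cft x v : continuous (fun t => f x v (cl t)).
  move=> t; apply: (@continuous_comp _ _ _ (fun t => (x, v, cl t)) (uncurry3 f)).
    exact: (cvg_pair (cvg_cst (x, v)) (ccl t)).
  exact: cf.
have cfx v t : 0 < t < T -> continuous (fun x => f x v t).
  move=> tT x; apply: (@continuous_comp _ _ _ (fun x => (x, v, t)) (uncurry3 f)).
    exact: (cvg_pair (cvg_pair cvg_id (cvg_cst v)) (cvg_cst t)).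
  exact: cf.
pose A (i : nat * rat * rat) : set R :=
  if (a <= ratr i.1.2) && (ratr i.2 <= b) && (i.1.2 < i.2) then
    [set x | forall t v, ratr i.1.2 <= t <= ratr i.2 -> i.1.1%:R <= `|v| -> `|f x v t| <= eps]
  else set0.
have clA i : closed (A i).
  rewrite /A; case: ifP => [/andP[/andP[ai ib] _]|_]; last exact: closed0.
  rewrite (_ : [set _ | _] = \bigcap_(p in [set p : R * R |
      ratr i.1.2 <= p.1 <= ratr i.2 /\ i.1.1%:R <= `|p.2|])
      [set x | `|f x p.2 p.1| <= eps]).
    apply: closed_bigI => -[t v] /= [tt _]; apply: closed_le_norm.
    by apply: cfx; lra.
  apply/seteqP; split => [x /= h [t v] /= []|x /= h t v h1 h2]; first exact: h.
  exact: (h (t, v)).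
have covA x : 0 < x < 1 -> exists i, A i x.
  move=> _.
  have [M [c [d [ac cd db hM]]]] : exists (M : nat) c d, [/\ a < c, c < d, d < b &
      forall t, c <= t <= d -> (forall v, M%:R <= `|v| -> `|f x v (cl t)| <= eps)].
    apply: (@baire_segment _ _ (fun (M : nat) => [set t | forall v, M%:R <= `|v| ->
      `|f x v (cl t)| <= eps])) => // [M|t tab].
      rewrite (_ : [set _ | _] = \bigcap_(v in [set v : R | M%:R <= `|v|])
        [set t | `|f x v (cl t)| <= eps]).
        by apply: closed_bigI => v _; apply: closed_le_norm.
      by apply/seteqP; split => t.
    by apply: decay; have := clT t; lra.
  have [q1] : exists q, ratr q \in `]c, d[ by apply: rat_in_itvoo.
  rewrite in_itv /= => /andP[cq1 q1d].
  have [q2] : exists q, ratr q \in `]ratr q1, d[ by apply: rat_in_itvoo.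
  rewrite in_itv /= => /andP[q1q2 q2d].
  exists (M, q1, q2); rewrite /A /=.
  rewrite -(ltr_rat R) q1q2 (ltW (lt_trans ac cq1)) (ltW (lt_trans q2d db)) /=.
  by move=> t v tq Mv; rewrite -(clE t); [apply: hM => //|]; lra.
have [[[M q1] q2] [c [d [_ cd _ hA]]]] := baire_segment ltr01 clA covA.
have : A (M, q1, q2) c by apply: hA; lra.
rewrite /A; case: ifP => // Q _.
have {}hA x : c <= x <= d -> forall t v, ratr q1 <= t <= ratr q2 -> M%:R <= `|v| ->
    `|f x v t| <= eps by move=> /hA; rewrite /A Q.
move: Q => /= /andP[/andP[aq1 q2b]]; rewrite -(ltr_rat R) => q12.
exists M%:R, ((c + d) / 2), ((d - c) / 2), (ratr q1), (ratr q2).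
split; [lra|by []|lra|lra|].
move=> x v t xc tt Mv; apply: hA => //.
by move: xc; rewrite ler_norml; lra.
Qed.

(** Positive times precede the window. Time 0, where the equation is not assumed to
hold, is reached by continuity. *)
Lemma vanishing_at_infinity (t1 eps : R) : Omega_v = setT -> 0 < t1 < T -> 0 < eps ->
  (forall x t, 0 <= t < T -> exists M : nat, forall v, M%:R <= `|v| -> `|f x v t| <= eps) ->
  exists V, forall x v t, 0 <= t <= t1 -> V <= `|v| -> `|F x v t| <= eps.
Proof.
move=> OT t1T eps0 decay.
have t1T' : 0 <= t1 < T by lra.
have [M [c [r [a [b [t1a ab bT r0 small]]]]]] := small_window OT t1T' decay.
have [K K0 EK] := E_bounded hf bT.
have FE x v t : F x v t = f x v t by rewrite /zero_ext OT in_setT.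
pose V := Num.max M (P / (b - a)) + K * T.
have pos x v t : 0 < t <= t1 -> V <= `|v| -> `|F x v t| <= eps.
  move=> tt Vv.
  have [t0 ta] : 0 < t /\ t < a by lra.
  apply: (@small_on_window_small_before M c r a b eps x v t K) => //.
    exact: ltW.
  by move=> y w s yc sab Mw; rewrite FE; exact: small.
exists V => x v t /andP[]; rewrite le_eqVlt => /orP[/eqP <- _|t0 tt1] Vv; last first.
  by apply: pos => //; rewrite t0.
rewrite leNgt; apply/negP => big.
have T0 : closure Omega_v v /\ 0 <= (0 : R) < T.
  by split; [apply: subset_closure; rewrite OT|lra].
have /subspace_continuousP/(_ (x, v, 0) T0)/cvgrPdist_lt := vp_f_continuous hf.
move: big; rewrite FE => big.
move=> /(_ (`|f x v 0| - eps)); rewrite subr_gt0 => /(_ big).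
move=> /nbhs_ballP[e /= e0 near0].
pose t' := Num.min (e / 2) t1.
have t'0 : 0 < t' by rewrite lt_min divr_gt0//=; lra.
have t'1 : t' <= t1 by rewrite ge_min lexx orbT.
have t'e : t' < e by rewrite gt_min; apply/orP; left; lra.
have bt : ball (x, v, 0 : R) e (x, v, t').
  by split; [split; exact: ballxx|rewrite /ball /= sub0r normrN gtr0_norm].
have st : closure Omega_v v /\ 0 <= t' < T.
  by split; [apply: subset_closure; rewrite OT|lra].
have := near0 (x, v, t') bt st; rewrite /uncurry3 /= => near'.
have := pos x v t'; rewrite FE t'0 t'1 => /(_ isT Vv) small'.
by have := lerB_dist (f x v 0) (f x v t'); lra.
Qed.
(** Compactness of the set of positions and times makes the distance to the boundary
velocity [w] uniform. *)
Lemma boundary_small (w t1 eps : R) : t1 < T -> 0 < eps ->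
  closure Omega_v w -> (forall x t, 0 <= t < T -> f x w t = 0) ->
  exists2 d, 0 < d & forall x v t, 0 <= t <= t1 -> Omega_v v -> `|v - w| < d ->
    `|f x v t| <= eps.
Proof.
move=> t1T eps0 cw fw.
pose K : set (R * R) := `[0, P] `*` `[0, t1].
have cK : compact K by apply: compact_setX; exact: segment_compact.
pose Q v (p : R * R) := Omega_v v -> 0 <= p.2 <= t1 -> `|f p.1 v p.2| <= eps.
have [/(_ cK) covK _] := compact_near_coveringP K.
have /nbhs_ballP[d /= d0 dQ] : \forall v \near w, K `<=` Q v.
  apply: (covK R (nbhs w) Q) => -[x0 t0] [/= _]; rewrite in_itv /= => t0b.
  have dom : closure Omega_v w /\ 0 <= t0 < T by split => //; lra.
  have /subspace_continuousP/(_ (x0, w, t0) dom)/cvgrPdist_lt := vp_f_continuous hf.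
  have fw0 : uncurry3 f (x0, w, t0) = 0 by apply: fw => /=; lra.
  move=> /(_ eps eps0); rewrite /from_subspace fw0 => nearp.
  pose G := nbhs ((x0, t0), w).
  have cq : (q.1.1, q.2, q.1.2) @[q --> G] --> (x0, w, t0).
    have c1 : q.1 @[q --> G] --> (x0, t0) by exact: cvg_fst.
    have c2 : q.2 @[q --> G] --> w by exact: cvg_snd.
    have c11 : q.1.1 @[q --> G] --> x0.
      exact: (cvg_comp _ _ c1 (@cvg_fst _ _ (nbhs x0) (nbhs t0) _)).
    have c12 : q.1.2 @[q --> G] --> t0.
      exact: (cvg_comp _ _ c1 (@cvg_snd _ _ (nbhs x0) (nbhs t0) _)).
    exact: (cvg_pair (cvg_pair c11 c2) c12).
  suff : \forall q \near G, Q q.2 q.1 by [].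
  have nq : \forall q \near G, closure Omega_v q.2 /\ 0 <= q.1.2 < T ->
    `|0 - f q.1.1 q.2 q.1.2| < eps by exact: (cq _ nearp).
  apply: filterS nq => -[[x t] v] /= h Ov tt.
  apply: ltW; rewrite -normrN -sub0r; apply: h; split; first exact: subset_closure.
  by move: tt => /=; lra.
exists d => // x v t tt Ov vw.
have [m xm] := period_representative 0 x (@period_gt0 R).
rewrite -(periodic_int (P := P) (g := fun x => f x v t) _ m); last first.
  by move=> y; apply: (vp_f_periodic hf); [exact: subset_closure|lra].
apply: (dQ v _ (x + m%:~R * P, t)) => //; first by rewrite /ball /= distrC.
by split; rewrite /= in_itv /=; lra.
Qed.

(** The margin [d] leaves room for the change of velocity in one Euler step. *)
Lemma uniform_vanishing (t1 eps : R) : 0 < t1 < T -> 0 < eps ->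
  exists v1 v2 d, [/\ v1 < v2, 0 < d,
    forall v, v1 - d <= v <= v2 + d -> Omega_v v &
    forall x v t, 0 <= t <= t1 -> ~~ (v1 <= v <= v2) -> `|F x v t| <= eps].
Proof.
move=> t1T eps0; have t1T' : t1 < T by lra.
case: (vp_velocity hf) => [[vmin [vmax [vv OE bd]]]|[OT decay]]; last first.
  have decay' x t : 0 <= t < T -> exists M : nat, forall v, M%:R <= `|v| -> `|f x v t| <= eps.
    by move=> /(decay x t); exact: gaussian_decay_small.
  have [V FV] := vanishing_at_infinity OT t1T eps0 decay'.
  exists (- (`|V| + 1)), (`|V| + 1), 1; split => //.
  - by have := normr_ge0 V; lra.
  - by rewrite OT.
  - move=> x v t tt vV; apply: FV => //.
    rewrite leNgt; apply: contra vV => vV.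
    by rewrite -ler_norml; have := ler_norm V; lra.
have clO w : vmin <= w <= vmax -> closure Omega_v w.
  by move=> wv; rewrite OE; exact: closure_open_segment.
have [d1 d10 small1] : exists2 d, 0 < d & forall x v t, 0 <= t <= t1 -> Omega_v v ->
    `|v - vmin| < d -> `|f x v t| <= eps.
  apply: boundary_small => //; first by apply: clO; lra.
  by move=> x t /(bd x t)[].
have [d2 d20 small2] : exists2 d, 0 < d & forall x v t, 0 <= t <= t1 -> Omega_v v ->
    `|v - vmax| < d -> `|f x v t| <= eps.
  apply: boundary_small => //; first by apply: clO; lra.
  by move=> x t /(bd x t)[].
pose d := Num.min (Num.min d1 d2) (vmax - vmin) / 8.
have d0 : 0 < d by rewrite divr_gt0// !lt_min d10 d20 subr_gt0.
have dd1 : 8 * d <= d1 by rewrite mulrC divfK// !ge_min lexx.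
have dd2 : 8 * d <= d2 by rewrite mulrC divfK// !ge_min lexx orbT.
have ddv : 8 * d <= vmax - vmin by rewrite mulrC divfK// ge_min lexx orbT.
exists (vmin + 2 * d), (vmax - 2 * d), d; split => //; first by lra.
  by move=> v vd; rewrite OE /= in_itv /=; lra.
move=> x v t tt vout; rewrite /zero_ext; case: ifPn => [/set_mem Ov|]; last first.
  by rewrite normr0 ltW.
have : vmin < v < vmax by move: Ov; rewrite OE /= in_itv.
move=> vin; have [vl|vl] := ltP v (vmin + 2 * d).
  by apply: small1 => //; rewrite ltr_norml; lra.
have vr : vmax - 2 * d < v by rewrite ltNge; apply: contra vout => vr; rewrite vl.
by apply: small2 => //; rewrite ltr_norml; lra.
Qed.

End solution.

(** * Truncated squares *)

Ltac split_minmax := repeat match goal with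
  | |- context [Order.max ?x ?y] => case: (leP x y) => ?
  | |- context [Order.min ?x ?y] => case: (leP x y) => ?
  end.

Section truncation.
Context {R : realType}.

(** The lower cutoff confines the integrals to a compact set of velocities; the upper
one makes the square Lipschitz without a bound on the solution. *)
Definition trunc_abs (n : nat) (s : R) : R :=
  Num.min (Num.max (`|s| - n.+1%:R^-1) 0) n%:R.

Definition trunc_sq (n : nat) (s : R) : R := trunc_abs n s ^+ 2.

Lemma trunc_abs_itv n s : 0 <= trunc_abs n s <= n%:R.
Proof. by rewrite /trunc_abs le_min ge_min lexx orbT andbT le_max lexx orbT /=. Qed.

Lemma trunc_abs_lipschitz n s s' : `|trunc_abs n s - trunc_abs n s'| <= `|s - s'|.
Proof.
apply: le_trans (ler_dist_dist s s'); rewrite /trunc_abs.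
set c := _^-1; set a := `|s|; set b := `|s'|.
have n0 : 0 <= n%:R :> R by [].
have ab : - `|a - b| <= a - b <= `|a - b| by rewrite -ler_norml.
by split_minmax; rewrite ler_norml; lra.
Qed.

Lemma trunc_abs_continuous n : continuous (@trunc_abs n).
Proof.
move=> s; apply/cvgrPdist_lt => e e0.
have : \forall t \near s, `|s - t| < e by apply/nbhs_ballP; exists e.
by apply: filterS => t; apply: le_lt_trans; exact: trunc_abs_lipschitz.
Qed.

Lemma trunc_sq_measurable n : measurable_fun setT (@trunc_sq n).
Proof.
by apply: measurable_funX; apply: continuous_measurable_fun; exact: trunc_abs_continuous.
Qed.

Lemma trunc_sq_ge0 n s : 0 <= trunc_sq n s.
Proof. exact: sqr_ge0. Qed.

Lemma trunc_sq_le n s : trunc_sq n s <= n%:R ^+ 2.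
Proof.
by have /andP[? ?] := trunc_abs_itv n s; rewrite /trunc_sq lerXn2r// nnegrE.
Qed.

Lemma trunc_sq0 n s : `|s| <= n.+1%:R^-1 -> trunc_sq n s = 0.
Proof.
move=> sn; rewrite /trunc_sq /trunc_abs (max_idPr _) ?subr_le0//.
by rewrite (min_idPl _)// expr0n.
Qed.

Lemma trunc_sq_close n s s' c : `|s - s'| <= c ->
  trunc_sq n s <= trunc_sq n s' + 2 * n%:R * c.
Proof.
move=> ss; rewrite -lerBlDl /trunc_sq subr_sqr.
have /andP[a0 an] := trunc_abs_itv n s; have /andP[b0 bn] := trunc_abs_itv n s'.
rewrite mulrC; apply: (le_trans (ler_norm _)).
rewrite normrM; apply: ler_pM => //.
  by rewrite ger0_norm ?addr_ge0//; lra.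
exact: le_trans (trunc_abs_lipschitz _ _ _) ss.
Qed.

Lemma trunc_sq_nondecreasing s : {homo (trunc_sq ^~ s) : m n / (m <= n)%N >-> m <= n}.
Proof.
move=> m n mn; rewrite /trunc_sq.
have /andP[a0 _] := trunc_abs_itv m s; have /andP[b0 _] := trunc_abs_itv n s.
rewrite lerXn2r ?nnegrE// /trunc_abs.
have m0 : 0 <= m%:R :> R by [].
have mn' : m%:R <= n%:R :> R by rewrite ler_nat.
have : n.+1%:R^-1 <= m.+1%:R^-1 :> R by rewrite lef_pV2 ?posrE// ler_nat.
move: (n.+1%:R^-1) (m.+1%:R^-1) => c c' cc.
by split_minmax; lra.
Qed.

Lemma trunc_sq_cvg s : trunc_sq n s @[n --> \oo] --> s ^+ 2.
Proof.
rewrite -[s ^+ 2]real_normK ?num_real// expr2 /trunc_sq.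
have h : trunc_abs n s @[n --> \oo] --> `|s|.
  apply/cvgrPdist_le => e e0.
  have [M] : exists M : nat, `|s| <= M%:R.
    by exists (Num.truncn `|s|).+1; exact/ltW/truncnS_gt.
  move=> sM.
  have /cvgrPdist_le/(_ e e0) := @cvg_harmonic R; apply: filter_app.
  near=> n; rewrite sub0r normrN ger0_norm /= ?invr_ge0// => ne.
  have nM : `|s| <= n%:R by apply: (le_trans sM); rewrite ler_nat; near: n; exact: nbhs_infty_ge.
  have n0 : 0 < n.+1%:R^-1 :> R by rewrite invr_gt0.
  have := normr_ge0 s.
  rewrite /trunc_abs; move: (n.+1%:R^-1) ne n0 => c ce c0 s0.
  by split_minmax; rewrite ler_norml; lra.
by under eq_fun do rewrite expr2; exact: cvgM.
Unshelve. all: by end_near. Qed.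

End truncation.

(** * Conservation of the truncated masses *)

Section conservation.
Context {R : realType}.
Variables (T : R) (Omega_v : set R) (f0 : R -> R -> R) (f : R -> R -> R -> R).
Variable E : R -> R -> R.
Hypothesis hf : vlasov_poisson_solution T Omega_v f0 f E.
Local Notation P := (2 * pi : R).
Local Notation F := (zero_ext Omega_v f).
Local Notation mu := (@lebesgue_measure R).

(** The function is continuous on the open strip of admissible velocities and zero
off it, so only relatively open preimages in that strip have to be examined. *)
Lemma zero_ext_measurable t : 0 <= t < T ->
  measurable_fun setT (fun z : R * R => F z.1 z.2 t).
Proof.
move=> tT; pose D : set (R * R) := setT `*` Omega_v.
have oO := velocity_open hf.
have mD : measurable (D : set (measurableTypeR R * measurableTypeR R)).
  by apply: measurableX => //; exact: open_measurable.
have -> : (fun z : R * R => F z.1 z.2 t) = (fun z : R * R => f z.1 z.2 t) \_ D.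
  apply/funext => -[x v]; rewrite /patch /zero_ext /=.
  congr (if _ then _ else _); apply/idP/idP => /set_mem; first by move=> Ov; apply/mem_set.
  by case=> _ /= Ov; apply/mem_set.
apply/(measurable_restrictT _ mD).
apply: (measurability _ (RGenOpens.measurableE R)).
move=> _ [_ [a [b ->] <-]].
apply: open_measurable_plane; rewrite openE => -[x v] [[_ /= Ov] fab].
have dom : closure Omega_v v /\ 0 <= t < T by split => //; exact: subset_closure.
have /subspace_continuousP/(_ (x, v, t) dom) cvf := vp_f_continuous hf.
have nf : nbhs (uncurry3 f (x, v, t)) `]a, b[%classic.
  by apply: open_nbhs_nbhs; split; [exact: itv_open|].
have /nbhs_ballP[e /= e0 ef] := cvf _ nf.
have nO : \forall w \near v, Omega_v w by exact: open_nbhs_nbhs.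
have /nbhs_ballP[d /= d0 dO] := nO.
apply/nbhs_ballP; exists (Num.min e d); first by rewrite /= lt_min e0 d0.
move=> [y w] [/= xy vw].
have Ow : Omega_v w by apply: dO; apply: le_ball vw; rewrite ge_min lexx orbT.
split; first by split.
apply: (ef (y, w, t)); last by split => //; exact: subset_closure.
split; last exact: ballxx.
by split; [apply: le_ball xy|apply: le_ball vw]; rewrite ge_min lexx.
Qed.

Definition trunc_mass n t : \bar R :=
  (\int[mu \x mu]_(z in `[0%R, P[ `*` setT) (trunc_sq n (F z.1 z.2 t))%:E)%E.

Lemma trunc_zero_ext_measurable n t : 0 <= t < T ->
  measurable_fun setT (fun z : R * R => trunc_sq n (F z.1 z.2 t)).
Proof.
by move=> tT; apply: measurableT_comp (zero_ext_measurable tT); exact: trunc_sq_measurable.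
Qed.

Lemma field_measurable t : 0 < t < T -> measurable_fun setT (E ^~ t).
Proof.
move=> tT; apply: continuous_measurable_fun => x.
apply: (@continuous_comp _ _ _ (fun x => (x, t)) (fun p : R * R => E p.1 p.2)).
  exact: (cvg_pair cvg_id (cvg_cst t)).
exact: (E_continuous_interior hf tT).
Qed.

Lemma euler_step_measurable (h : R) (e : R -> R) : measurable_fun setT e ->
  measurable_fun setT (euler_step h e).
Proof.
move=> me; have m1 : measurable_fun setT (fun z : R * R => z.1 + h * z.2).
  by apply: measurable_funD => //; exact: measurable_funM.
apply: measurable_fun_pair => //; apply: measurable_funB => //.
by apply: measurable_funM => //; exact: measurableT_comp me m1.
Qed.

Lemma trunc_mass_euler n t h : 0 < t < T -> 0 <= t + h < T ->
  trunc_mass n (t + h) = (\int[mu \x mu]_(z in `[0%R, P[ `*` setT)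
    (trunc_sq n (uncurry3 F (euler_step h (E ^~ t) z, (t + h)%R)))%:E)%E.
Proof.
move=> tT thT; rewrite /trunc_mass.
rewrite -(@ge0_integral_euler_step _ P h
  (fun z : R * R => (trunc_sq n (F z.1 z.2 (t + h)))%:E) (E ^~ t))//.
- exact: period_gt0.
- by apply/measurable_EFinP; exact: trunc_zero_ext_measurable.
- by move=> z; rewrite lee_fin trunc_sq_ge0.
- by move=> x v; rewrite /= (zero_ext_periodic hf).
- exact: field_measurable.
- by move=> x; apply: (vp_E_periodic hf); lra.
Qed.

(** Both masses are integrals over the same strip once the later one has been pulled
back by an Euler step; the integrands differ by a multiple of [eta * `|h|] on a
bounded set of velocities, outside of which both vanish. *)
Lemma trunc_mass_increment n t e : 0 < t < T -> 0 < e ->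
  \forall h \near (0 : R),
    `|fine (trunc_mass n (t + h)) - fine (trunc_mass n t)| <= e * `|h|.
Proof.
move=> tT e0; pose b := (t + T) / 2.
have [tb bT] : t < b /\ b < T by rewrite /b; lra.
have b0T : 0 < b < T by lra.
have n0 : 0 < n.+1%:R^-1 :> R by rewrite invr_gt0.
have [v1 [v2 [d [v12 d0 dO small]]]] := uniform_vanishing hf b0T n0.
have [K K0 EK] := E_bounded hf bT.
(* A step with `|h| * K < d started outside [w1, w2] ends outside [v1, v2]. *)
pose w1 := v1 - d; pose w2 := v2 + d.
have w12 : w1 < w2 by rewrite /w1 /w2; lra.
have L0 : 0 < P * (w2 - w1) by rewrite mulr_gt0 ?period_gt0// subr_gt0.
pose eta := e / ((2 * n%:R + 1) * (P * (w2 - w1))).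
have n20 : 0 < 2 * n%:R + 1 :> R by rewrite ltr_wpDl// mulr_ge0.
have eta0 : 0 < eta by rewrite divr_gt0// mulr_gt0.
have [t0 _] := andP tT.
have tt : t < T by lra.
have stepn := transport_step_uniform hf t0 tt dO eta0.
pose m := Num.min (Num.min t (b - t)) (d / K).
have m0 : 0 < m by rewrite !lt_min t0 subr_gt0 tb divr_gt0.
have hmn : \forall h \near (0 : R), `|h| < m by exact: nbhs0_lt.
near=> h.
have : `|h| < m by near: h.
rewrite !lt_min => /andP[/andP[]]; rewrite !ltr_norml => ht hb hK.
have thT : 0 <= t + h < T by lra.
have tT' : 0 <= t < T by lra.
have step x v : w1 <= v <= w2 ->
    `|uncurry3 F (euler_step h (E ^~ t) (x, v), t + h) - F x v t| <= eta * `|h|.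
  move=> vw; have : forall x v t', v1 - d <= v <= v2 + d -> t <= t' <= t ->
    `|uncurry3 F (euler_step h (E^~ t') (x, v), t' + h) - F x v t'| <= eta * `|h|.
    by near: h.
  by apply => //; rewrite lexx.
rewrite trunc_mass_euler// /trunc_mass.
pose g1 (z : R * R) := trunc_sq n (uncurry3 F (euler_step h (E ^~ t) z, (t + h)%R)).
pose g2 (z : R * R) := trunc_sq n (F z.1 z.2 t).
have mg1 : measurable_fun setT g1.
  apply: measurableT_comp (trunc_zero_ext_measurable n thT) _.
  by apply: euler_step_measurable; exact: field_measurable.
have mg2 : measurable_fun setT g2 by exact: trunc_zero_ext_measurable.
have b1 z : 0 <= g1 z <= n%:R ^+ 2 by rewrite trunc_sq_ge0 trunc_sq_le.
have b2 z : 0 <= g2 z <= n%:R ^+ 2 by rewrite trunc_sq_ge0 trunc_sq_le.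
have s2 z : ~~ (w1 <= z.2 <= w2) -> g2 z = 0.
  move=> zw; apply: trunc_sq0; apply: small; first by lra.
  by apply: contra zw; rewrite /w1 /w2; lra.
have hE x : `|h * E x t| < d.
  rewrite normrM; apply: (@le_lt_trans _ _ (`|h| * K)).
    by rewrite ler_wpM2l// EK//; lra.
  by rewrite -ltr_pdivlMr// ltr_norml.
have s1 z : ~~ (w1 <= z.2 <= w2) -> g1 z = 0.
  move=> zw; apply: trunc_sq0; rewrite /uncurry3 /=; apply: small; first by lra.
  apply: contra zw; have := hE (z.1 + h * z.2); rewrite ltr_norml /w1 /w2.
  by move: (h * E _ _) => k; lra.
have c0 : 0 <= 2 * n%:R * (eta * `|h|).
  by apply: mulr_ge0; [exact: mulr_ge0|apply: mulr_ge0 => //; exact: ltW].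
apply: (@le_trans _ _ (2 * n%:R * (eta * `|h|) * (P * (w2 - w1)))).
  apply: (strip_integral_close (period_gt0) w12 mg1 mg2 b1 b2 s1 s2 c0).
    by move=> -[x v] vw; apply: trunc_sq_close; exact: step.
  by move=> -[x v] vw; apply: trunc_sq_close; rewrite distrC; exact: step.
have -> : 2 * n%:R * (eta * `|h|) * (P * (w2 - w1)) =
    (2 * n%:R) * (eta * (P * (w2 - w1))) * `|h| by ring.
rewrite ler_wpM2r//.
have -> : eta * (P * (w2 - w1)) = e / (2 * n%:R + 1).
  rewrite /eta; move: (P * _) (2 * n%:R + 1) L0 n20 => L N L1 N0.
  by field; rewrite !gt_eqF.
rewrite mulrA ler_pdivrMr// mulrC ler_pM2l//; lra.
Unshelve. all: by end_near. Qed.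

Lemma trunc_mass_derive n t : 0 < t < T ->
  is_derive t (1 : R) (fun s => fine (trunc_mass n s)) 0.
Proof.
move=> tT.
have c : h^-1 *: ((fun s => fine (trunc_mass n s)) (h *: 1 + t) -
    fine (trunc_mass n t)) @[h --> 0^'] --> (0 : R).
  apply/cvgrPdist_le => e e0.
  have := trunc_mass_increment n tT e0.
  move/nbhs_dnbhs; apply: filter_app; near=> h => hle.
  have h0 : h != 0 by near: h; exact: nbhs_dnbhs_neq.
  rewrite sub0r normrN normrZ normfV ler_pdivrMl ?normr_gt0//.
  by rewrite [leRHS]mulrC [h%:A]mulr1 [h + t]addrC.
apply: DeriveDef; first by apply/cvg_ex; exists 0.
exact: cvg_lim.
Unshelve. all: by end_near. Qed.

(** At time 0 there is no derivative to use: continuity of the solution on the compact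
set of relevant positions and velocities is enough. *)
Lemma trunc_mass_cvg0 n : 0 < T ->
  fine (trunc_mass n t) @[t --> 0^'+] --> fine (trunc_mass n 0).
Proof.
move=> T0; apply/cvgrPdist_le => e e0.
have b0T : 0 < T / 2 < T by lra.
have n0 : 0 < n.+1%:R^-1 :> R by rewrite invr_gt0.
have [v1 [v2 [d [v12 d0 dO small]]]] := uniform_vanishing hf b0T n0.
have L0 : 0 < P * (v2 - v1) by rewrite mulr_gt0 ?period_gt0// subr_gt0.
pose eta := e / ((2 * n%:R + 1) * (P * (v2 - v1))).
have n20 : 0 < 2 * n%:R + 1 :> R by rewrite ltr_wpDl// mulr_ge0.
have eta0 : 0 < eta by rewrite divr_gt0// mulr_gt0.
pose K : set (R * R) := `[0, P] `*` `[v1, v2].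
have cK : compact K by apply: compact_setX; exact: segment_compact.
pose Q t (p : R * R) := 0 <= t < T -> `|f p.1 p.2 0 - f p.1 p.2 t| <= eta.
have [/(_ cK) covK _] := compact_near_coveringP K.
have nK : \forall t \near (0 : R), K `<=` Q t.
  apply: (covK R (nbhs (0 : R)) Q) => -[x0 v0] [/= _]; rewrite in_itv /= => v0v.
  have Ov0 : Omega_v v0 by apply: dO; lra.
  have nO : \forall w \near v0, Omega_v w.
    by apply: open_nbhs_nbhs; split => //; exact: (velocity_open hf).
  have dom : closure Omega_v v0 /\ 0 <= (0 : R) < T.
    by split; [exact: subset_closure|lra].
  have eta20 : 0 < eta / 2 by lra.
  have /subspace_continuousP/(_ (x0, v0, 0) dom)/cvgrPdist_lt/(_ _ eta20) :=
    vp_f_continuous hf.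
  rewrite /from_subspace => nearp.
  have c1 : q.1 @[q --> nbhs (x0, v0, (0 : R))] --> (x0, v0) by exact: cvg_fst.
  have cq : (q.1, 0 : R) @[q --> nbhs (x0, v0, (0 : R))] --> (x0, v0, (0 : R)).
    exact: (cvg_pair c1 (cvg_cst 0)).
  have nq : \forall q \near nbhs (x0, v0, (0 : R)), closure Omega_v q.1.2 /\ 0 <= (0 : R) < T ->
    `|uncurry3 f (x0, v0, 0) - uncurry3 f (q.1, 0)| < eta / 2 by exact: (cq _ nearp).
  have c12 : q.1.2 @[q --> nbhs (x0, v0, (0 : R))] --> v0.
    exact: (cvg_comp _ _ c1 (@cvg_snd _ _ (nbhs x0) (nbhs v0) _)).
  have nOq : \forall q \near nbhs (x0, v0, (0 : R)), Omega_v q.1.2 by exact: (c12 _ nO).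
  suff : \forall q \near nbhs (x0, v0, (0 : R)), Q q.2 q.1 by [].
  near=> q => /= qT.
  have Oq : closure Omega_v q.1.2 by apply: subset_closure; near: q.
  have h1 : `|uncurry3 f (x0, v0, 0) - uncurry3 f (q.1, 0)| < eta / 2.
    suff : closure Omega_v q.1.2 /\ 0 <= (0 : R) < T ->
      `|uncurry3 f (x0, v0, 0) - uncurry3 f (q.1, 0)| < eta / 2.
      by apply; split => //; lra.
    by near: q.
  have h2 : `|uncurry3 f (x0, v0, 0) - uncurry3 f q| < eta / 2.
    suff : closure Omega_v q.1.2 /\ 0 <= q.2 < T ->
      `|uncurry3 f (x0, v0, 0) - uncurry3 f q| < eta / 2 by apply.
    by near: q.
  move: h1 h2; rewrite /uncurry3 /=.
  set A := f _ _ 0; set B := f q.1.1 _ 0; set C := f _ _ q.2 => h1 h2.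
  have -> : B - C = (A - C) - (A - B) by ring.
  by rewrite (le_trans (ler_normB _ _))//; lra.
have T2 : 0 < T / 2 by lra.
have nT : \forall t \near (0 : R), `|t| < T / 2 by exact: nbhs0_lt.
have nT' : \forall t \near (0 : R)^'+, `|t| < T / 2 by apply: filterS nT => s + _.
have nK' : \forall t \near (0 : R)^'+, K `<=` Q t by apply: filterS nK => s + _.
near=> t.
have t0 : 0 < t by near: t; exact: nbhs_right_gt.
have tT2 : t < T / 2.
  have : `|t| < T / 2 by near: t.
  by rewrite gtr0_norm.
have tT : 0 <= t < T by lra.
have KQ : K `<=` Q t by near: t.
have O0 : 0 <= (0 : R) < T by lra.
have close x v : v1 <= v <= v2 -> `|F x v 0 - F x v t| <= eta.
  move=> vv; have Ov : Omega_v v by apply: dO; lra.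
  have [m xm] := period_representative 0 x (@period_gt0 R).
  rewrite -(periodic_int (P := P) (g := fun x => F x v 0) _ m); last first.
    by move=> y; exact: (zero_ext_periodic hf).
  rewrite -(periodic_int (P := P) (g := fun x => F x v t) _ m); last first.
    by move=> y; exact: (zero_ext_periodic hf).
  rewrite /zero_ext mem_set//; apply: (KQ (x + m%:~R * P, v)) => //.
  by split; rewrite /= in_itv /=; lra.
have c0 : 0 <= 2 * n%:R * eta by apply: mulr_ge0; [exact: mulr_ge0|exact: ltW].
apply: (@le_trans _ _ (2 * n%:R * eta * (P * (v2 - v1)))).
  apply: (@strip_integral_close _ _ _ _ (n%:R ^+ 2)) => //.
  - exact: period_gt0.
  - exact: trunc_zero_ext_measurable.
  - exact: trunc_zero_ext_measurable.
  - by move=> z; rewrite trunc_sq_ge0 trunc_sq_le.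
  - by move=> z; rewrite trunc_sq_ge0 trunc_sq_le.
  - by move=> z zv; apply: trunc_sq0; apply: small => //; lra.
  - by move=> z zv; apply: trunc_sq0; apply: small => //; lra.
  - by move=> z zv; apply: trunc_sq_close; exact: close.
  - by move=> z zv; apply: trunc_sq_close; rewrite distrC; exact: close.
rewrite -mulrA.
have -> : eta * (P * (v2 - v1)) = e / (2 * n%:R + 1).
  rewrite /eta; move: (P * _) (2 * n%:R + 1) L0 n20 => L N L1 N0.
  by field; rewrite !gt_eqF.
rewrite mulrA ler_pdivrMr// mulrC ler_pM2l//; lra.
Unshelve. all: by end_near. Qed.

Lemma trunc_mass_fin n t : 0 <= t < T -> trunc_mass n t \is a fin_num.
Proof.
move=> tT; have b0T : 0 < (t + T) / 2 < T by lra.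
have n0 : 0 < n.+1%:R^-1 :> R by rewrite invr_gt0.
have [v1 [v2 [d [v12 d0 dO small]]]] := uniform_vanishing hf b0T n0.
rewrite ge0_fin_numE; last by apply: integral_ge0 => z _; rewrite lee_fin trunc_sq_ge0.
apply: (strip_integral_lty (@period_gt0 R) v12 (trunc_zero_ext_measurable n tT)
  (B := n%:R ^+ 2)) => z.
  by rewrite trunc_sq_ge0 trunc_sq_le.
by move=> zv; apply: trunc_sq0; apply: small => //; lra.
Qed.

Lemma trunc_mass_constant n t : 0 < T -> 0 <= t < T -> trunc_mass n t = trunc_mass n 0.
Proof.
move=> T0 /andP[]; rewrite le_eqVlt => /orP[/eqP <- //|t0] tT.
rewrite -[LHS]fineK ?trunc_mass_fin//; last by lra.
rewrite -[RHS]fineK ?trunc_mass_fin//; last by lra.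
congr (_%:E); apply/eqP; rewrite -subr_eq0; apply/eqP.
have dm s : s \in `]0, t[ -> is_derive s 1 (fun s => fine (trunc_mass n s)) ((fun=> 0) s).
  by rewrite in_itv /= => st; apply: trunc_mass_derive; lra.
have cm s : 0 < s < T -> {for s, continuous (fun s => fine (trunc_mass n s))}.
  move=> sT; apply/differentiable_continuous/derivable1_diffP.
  by have [] := trunc_mass_derive n sT.
have ct : {within `[0, t], continuous (fun s => fine (trunc_mass n s))}.
  apply/continuous_within_itvP => //; split.
  - by move=> s; rewrite in_itv /= => st; apply: cm; lra.
  - exact: trunc_mass_cvg0.
  - by apply: cvg_at_left_filter; apply: cm; lra.
by have [c _ ->] := MVT t0 dm ct; rewrite mul0r.
Qed.

Lemma zero_ext_sq_integral t : 0 < T -> 0 <= t < T ->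
  (\int[mu \x mu]_(z in `[0%R, P[ `*` setT) (F z.1 z.2 t ^+ 2)%:E =
   \int[mu \x mu]_(z in `[0%R, P[ `*` setT) (F z.1 z.2 0 ^+ 2)%:E)%E.
Proof.
move=> T0 tT.
have lim_mass s : 0 <= s < T ->
    (\int[mu \x mu]_(z in `[0%R, P[ `*` setT) (F z.1 z.2 s ^+ 2)%:E =
     limn (trunc_mass ^~ s))%E.
  move=> sT.
  have mS : measurable (`[0, P[ `*` setT : set (measurableTypeR R * measurableTypeR R)).
    by apply: measurableX => //; exact: measurable_itv.
  rewrite -(monotone_convergence (mu \x mu)%E mS
    (g' := fun n (z : R * R) => (trunc_sq n (F z.1 z.2 s))%:E)) //.
  - apply: eq_integral => z _; apply/esym/cvg_lim => //.
    by apply: cvg_EFin; [exact: nearW|exact: trunc_sq_cvg].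
  - by move=> n; apply/measurable_EFinP/measurable_funTS; exact: trunc_zero_ext_measurable.
  - by move=> n z _; rewrite lee_fin trunc_sq_ge0.
  - by move=> z _ m n mn; rewrite lee_fin; exact: trunc_sq_nondecreasing.
rewrite !lim_mass//; last by lra.
by congr (limn _); apply/funext => n; exact: trunc_mass_constant.
Qed.

Lemma L2normE t :
  L2norm Omega_v (fun x v => f x v t) =
  ((\int[mu \x mu]_(z in `[0%R, P[ `*` setT) (F z.1 z.2 t ^+ 2)%:E) `^ 2^-1)%E.
Proof.
rewrite /L2norm unlock; congr (_ `^ _)%E.
rewrite [RHS]integral_mkcond; apply: eq_integral => -[x v] _.
rewrite /= /patch /phase_space /zero_ext.
case: ifPn => [/set_mem[/= xP Ov]|nxv].
  rewrite !mem_set//= (powR_mulrn 2) ?normr_ge0//.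
  by rewrite real_normK ?num_real.
have p0 : point = 0 :> R by [].
rewrite p0 normr0 powR0 ?pnatr_eq0//.
case: ifPn => // /set_mem[/= xP _]; case: ifPn => [/set_mem Ov|_]; last by rewrite expr0n.
by move/negP: nxv; case; apply/mem_set.
Qed.

Lemma L2norm_initial : L2norm Omega_v (fun x v => f x v 0) = L2norm Omega_v f0.
Proof.
rewrite /L2norm; apply: eq_Lnorm => -[x v] /=; rewrite /patch.
by case: ifPn => // /set_mem[/= _ Ov]; rewrite (vp_initial hf).
Qed.

Lemma L2norm_constant t : 0 < T -> 0 <= t < T ->
  L2norm Omega_v (fun x v => f x v t) = L2norm Omega_v f0.
Proof.
by move=> T0 tT; rewrite -L2norm_initial !L2normE zero_ext_sq_integral.
Qed.

End conservation.

(** * Conservation of the L2 norm *)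

Unset Implicit Arguments.

Theorem theorem3p1 (R : realType) (T : R) (Omega_v : set R)
    (f0 : R -> R -> R) (f : R -> R -> R -> R) (E : R -> R -> R)
    (hT : 0 < T)
    (hf : vlasov_poisson_solution T Omega_v f0 f E) :
  let N2 (t : R) : R := fine (L2norm Omega_v (fun x v => f x v t)) ^+ 2 in
  [/\ forall t : R, 0 < t < T -> is_derive t (1 : R) N2 0,
      (fun h : R => h^-1 * (N2 h - N2 0)) @ 0^'+ --> (0 : R) &
      forall t : R, 0 <= t < T ->
        L2norm Omega_v (fun x v => f x v t) = L2norm Omega_v f0].
Proof.
move=> N2.
have N2E t : 0 <= t < T -> N2 t = fine (L2norm Omega_v f0) ^+ 2.
  by move=> tT; rewrite /N2 (L2norm_constant hf hT tT).
split.
- move=> t tT; apply: (@near_eq_is_derive _ _ _ (cst (fine (L2norm Omega_v f0) ^+ 2))).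
  + have : \forall s \near t, s \in `]0, T[ by apply: near_in_itvoo; rewrite in_itv.
    by apply: filterS => s; rewrite in_itv /= => sT; rewrite N2E//; lra.
- have z : \forall h \near (0 : R)^'+, 0 = h^-1 * (N2 h - N2 0).
    near=> h; have h0 : 0 < h by near: h; exact: nbhs_right_gt.
    have hh : h < T by near: h; exact: nbhs_right_lt.
    by rewrite !N2E ?subrr ?mulr0//; lra.
  exact: cvg_trans (near_eq_cvg z) (cvg_cst _).
- by move=> t tT; exact: (L2norm_constant hf hT tT).
Unshelve. all: by end_near. Qed.
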